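(* Let $\Lambda$ be a filtered ring such that $\mathrm{gr}\Lambda$ is a commutative Noetherian ring and let $M$ be a filtered (left) $\Lambda$-module with a good filtration. Then the following (1) and (2) are equivalent. (1) $\text{G-dim}_{\mathrm{gr}\Lambda}\,\mathrm{gr}M=0$. (2) All of the following hold: (2.1) $\text{G-dim}_\Lambda M=0$; (2.2) whenever $\cdots\to F_1\xrightarrow{f_1}F_0\xrightarrow{f_0}M\to0$ is a filtered free resolution of $M$, all $f_i^*$ ($i>0$) are strict; (2.2$^*$) whenever $\cdots\to G_1\xrightarrow{g_1}G_0\xrightarrow{g_0}M^*\to0$ is a filtered free resolution of $M^*$, all $g_i^*$ ($i>0$) are strict; (2.3) the canonical map $\theta:M\to M^{**}$ is strict. Moreover, under these equivalent conditions, the maps $\varphi_M:\mathrm{gr}M^*\to(\mathrm{gr}M)^*$ and $\varphi_{M^*}:\mathrm{gr}M^{**}\to(\mathrm{gr}M^* )^*$ are isomorphisms.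
   Context: A filtered ring is a ring $\Lambda$ with additive subgroups $\mathcal F_p\Lambda$ ($p\in\mathbb N=\{0,1,2,\dots\}$) such that $1\in\mathcal F_0\Lambda$, $\mathcal F_p\Lambda\subset\mathcal F_{p+1}\Lambda$, $(\mathcal F_p\Lambda)(\mathcal F_q\Lambda)\subset\mathcal F_{p+q}\Lambda$, $\Lambda=\bigcup_p\mathcal F_p\Lambda$; put $\mathcal F_p\Lambda=0$ for $p<0$ and $\mathrm{gr}\Lambda=\bigoplus_{p\ge 0}\mathcal F_p\Lambda/\mathcal F_{p-1}\Lambda$, a graded ring. When $\mathrm{gr}\Lambda$ is commutative Noetherian, $\Lambda$ is left and right Noetherian. A filtration of a $\Lambda$-module $M$ is a family of additive subgroups $\mathcal F_pM$ ($p\in\mathbb Z$) with $\mathcal F_pM\subset\mathcal F_{p+1}M$, $\mathcal F_{-p}M=0$ for $p\gg0$, $(\mathcal F_p\Lambda)(\mathcal F_qM)\subset\mathcal F_{p+q}M$, $M=\bigcup_p\mathcal F_pM$ (similarly for right modules); put $\mathrm{gr}M=\bigoplus_{p\in\mathbb Z}\mathcal F_pM/\mathcal F_{p-1}M$, a graded $\mathrm{gr}\Lambda$-module, and let $\tau_p$ denote the natural map $\mathcal F_pM\to\mathcal F_pM/\mathcal F_{p-1}M$. The filtration is good if there are $p_1,\dots,p_r\in\mathbb Z$, $m_1,\dots,m_r\in M$ with $\mathcal F_pM=\sum_{k=1}^r(\mathcal F_{p-p_k}\Lambda)m_k$ for all $p\in\mathbb Z$. A $\Lambda$-homomorphism $f:M\to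 N$ of filtered modules is filtered if $f(\mathcal F_pM)\subset\mathcal F_pN$ for all $p$, and strict if $f(\mathcal F_pM)=\mathrm{Im}f\cap\mathcal F_pN$ for all $p$. A filtered free module (of finite rank) is a free module with basis $e_1,\dots,e_r$ and filtration $\mathcal F_pF=\bigoplus_k(\mathcal F_{p-p_k}\Lambda)e_k$ for some $p_k\in\mathbb Z$. A filtered free resolution is an exact sequence $\cdots\to F_1\to F_0\to M\to0$ in which all $F_i$ are filtered free (of finite rank) and all homomorphisms are strict filtered homomorphisms. $X^*=\mathrm{Hom}_\Lambda(X,\Lambda)$. If $X$ has a good filtration, $X^*$ is given the (good) filtration $\mathcal F_pX^*=\{f\in X^*: f(\mathcal F_qX)\subset\mathcal F_{p+q}\Lambda\ \text{for all }q\in\mathbb Z\}$; the same for right modules, so $M^*$ and $M^{**}$ are filtered. $\varphi_X:\mathrm{gr}X^*\to(\mathrm{gr}X)^*=\mathrm{Hom}_{\mathrm{gr}\Lambda}(\mathrm{gr}X,\mathrm{gr}\Lambda)$ is the $\mathrm{gr}\Lambda$-homomorphism given by $\varphi_X(\tau_p(f))(\tau_q(x))=\sigma_{p+q}(f(x))$ for $f\in\mathcal F_pX^*$, $x\in\mathcal F_qX$, where $\sigma_p:\mathcal F_p\Lambda\to\mathcal F_p\Lambda/\mathcal F_{p-1}\Lambda$ is the natural map. For a left and right Noetherian ring $\Gamma$ and a finitely generated $\Gamma$-module $X$, $\text{G-dim}_\Gamma X=0$ means that the canonical map $X\to X^{**}$ is an isomorphism and $\mathrm{Ext}^k_\Gamma(X,\Gamma)=0=\mathrm{Ext}^k_{\Gamma^{\rm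 op}}(X^*,\Gamma)$ for all $k>0$ (duals taken over $\Gamma$). *)

(* Defs.v *)
From HB Require Import structures.
From mathcomp Require Import all_boot all_order all_algebra.
From mathcomp Require Import generic_quotient ring_quotient.
From mathcomp Require Import finmap boolp classical_sets functions.
From mathcomp Require Import cardinality fsbigop.

Set Implicit Arguments.
Unset Strict Implicit.
Unset Printing Implicit Defensive.

Import GRing.Theory.
Local Open Scope ring_scope.
Local Open Scope quotient_scope.

Section Subquotient.
Variable V : zmodType.

Definition zsub (S : zmodClosed V) : Type := {x : V | x \in S}.

Section Zsub.
Variable S : zmodClosed V.
HB.instance Definition _ := [isSub of zsub S for @sval V _].
HB.instance Definition _ := [Choice of zsub S by <:].
HB.instance Definition _ := [SubChoice_isSubZmodule of zsub S by <:].
End Zsub.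

Variables A B : zmodClosed V.

Definition zsub_in : {pred zsub A} := fun u => val u \in B.

Lemma zsub_inE u : (u \in zsub_in) = (val u \in B).
Proof. by []. Qed.

Lemma zsub_in_zmod_closed : zmod_closed zsub_in.
Proof.
split=> [|u v]; rewrite !zsub_inE; first by rewrite raddf0 rpred0.
by move=> uB vB; rewrite raddfB rpredB.
Qed.
HB.instance Definition _ :=
  GRing.isZmodClosed.Build (zsub A) zsub_in zsub_in_zmod_closed.

(** [A / (A :&: B)], i.e. [A / B] when [B] is contained in [A] *)
Definition subquo : zmodType := Quotient.quot zsub_in.

(** The class of [x]; the junk value 0 is used when [x] is not in [A]. *)
Definition to_subquo (x : V) : subquo := \pi_subquo (insubd (0 : zsub A) x).

Definition subquo_repr (u : subquo) : V := val (repr u).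

Lemma subquo_reprP u : subquo_repr u \in A.
Proof. exact: valP. Qed.

Lemma subquo_reprK : cancel subquo_repr to_subquo.
Proof. by move=> u; rewrite /to_subquo /subquo_repr valKd reprK. Qed.

Lemma eq_to_subquo x y : x \in A -> y \in A ->
  (to_subquo x == to_subquo y) = (x - y \in B).
Proof.
move=> xA yA; rewrite /to_subquo -Quotient.idealrBE zsub_inE raddfB /=.
by rewrite !insubdK.
Qed.

Lemma to_subquoB x y : x \in A -> y \in A ->
  to_subquo (x - y) = to_subquo x - to_subquo y.
Proof.
move=> xA yA; rewrite /to_subquo.
have -> : insubd 0 (x - y) = insubd 0 x - insubd 0 y :> zsub A.
  by apply: val_inj; rewrite raddfB /= !insubdK ?rpredB.
exact: (raddfB \pi_(Quotient.quot zsub_in)).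
Qed.

Lemma to_subquo0 : to_subquo 0 = 0.
Proof. by rewrite -(subrr 0) to_subquoB ?rpred0 ?subrr. Qed.

Lemma to_subquoD x y : x \in A -> y \in A ->
  to_subquo (x + y) = to_subquo x + to_subquo y.
Proof.
move=> xA yA; have Ny : - y \in A by rewrite rpredN.
rewrite -{1}[y]opprK to_subquoB // -[- y]add0r to_subquoB ?rpred0 //.
by rewrite to_subquo0 add0r opprK.
Qed.

Lemma to_subquo_eq0 x : x \in A -> (to_subquo x == 0) = (x \in B).
Proof. by move=> xA; rewrite -to_subquo0 eq_to_subquo ?rpred0 // subr0. Qed.

End Subquotient.

Section DirectSum.
Variables (I : choiceType) (V : I -> zmodType).

Record dirsum := DirSum {
  dirsum_fun :> forall i, V i;
  dirsum_finite : finite_set [set i | dirsum_fun i != 0]%classic }.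

Lemma dirsumP (a b : dirsum) : (forall i, a i = b i) -> a = b.
Proof.
case: a b => [a fa] [b fb] /= ab.
have {}ab : a = b by apply: functional_extensionality_dep.
by case: _ / ab fb => fb; congr DirSum; apply: Prop_irrelevance.
Qed.

HB.instance Definition _ := gen_eqMixin dirsum.
HB.instance Definition _ := gen_choiceMixin dirsum.

Lemma dirsum0_finite : finite_set [set i | (0 : V i) != 0]%classic.
Proof.
rewrite (_ : [set _ | _]%classic = set0) //.
by apply/seteqP; split=> i //=; rewrite eqxx.
Qed.
Definition dirsum0 := DirSum dirsum0_finite.

Lemma dirsumN_finite (a : dirsum) : finite_set [set i | - a i != 0]%classic.
Proof.
by apply: sub_finite_set (dirsum_finite a) => i /=; rewrite oppr_eq0.
Qed.
Definition dirsumN a := DirSum (dirsumN_finite a).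

Lemma dirsumD_finite (a b : dirsum) :
  finite_set [set i | a i + b i != 0]%classic.
Proof.
apply: (@sub_finite_set _ _
    ([set i | a i != 0] `|` [set i | b i != 0])%classic); last first.
  by rewrite finite_setU; split; apply: dirsum_finite.
move=> i /= ab0.
by have [ai0|] := eqVneq (a i) 0; [right; rewrite ai0 add0r in ab0|left].
Qed.
Definition dirsumD a b := DirSum (dirsumD_finite a b).

Lemma dirsum_addA : associative dirsumD.
Proof. by move=> a b c; apply: dirsumP => i /=; rewrite addrA. Qed.
Lemma dirsum_addC : commutative dirsumD.
Proof. by move=> a b; apply: dirsumP => i /=; rewrite addrC. Qed.
Lemma dirsum_add0 : left_id dirsum0 dirsumD.
Proof. by move=> a; apply: dirsumP => i /=; rewrite add0r. Qed.
Lemma dirsum_addN : left_inverse dirsum0 dirsumN dirsumD.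
Proof. by move=> a; apply: dirsumP => i /=; rewrite addNr. Qed.
HB.instance Definition _ := GRing.isZmodule.Build dirsum
  dirsum_addA dirsum_addC dirsum_add0 dirsum_addN.

Lemma dirsumDE (a b : dirsum) i : (a + b) i = a i + b i.
Proof. by []. Qed.
Lemma dirsum0E i : (0 : dirsum) i = 0.
Proof. by []. Qed.

Lemma dirsum_sumE J (r : seq J) (P : pred J) (F : J -> dirsum) i :
  (\sum_(j <- r | P j) F j) i = \sum_(j <- r | P j) F j i.
Proof. by elim/big_rec2: _ => // j x y _ <-. Qed.

(** The injection of the summand [V i], given as the function that is [v] at
    [i] and 0 elsewhere *)
Definition dirsum_in_fun i (v : V i) : forall j, V j := 
  @dfwith I (fun j => V j : Type) (fun=> 0) i v.

Lemma dirsum_in_finite i (v : V i) :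
  finite_set [set j | dirsum_in_fun v j != 0]%classic.
Proof.
apply: sub_finite_set (finite_set1 i) => j /=; rewrite /dirsum_in_fun.
by case: dfwithP => // k _; rewrite eqxx.
Qed.
Definition dirsum_in i (v : V i) := DirSum (dirsum_in_finite v).

Lemma dirsum_inE i (v : V i) : dirsum_in v i = v.
Proof. exact: dfwith_in. Qed.
Lemma dirsum_in_neq i (v : V i) j : i != j -> dirsum_in v j = 0.
Proof. exact: dfwith_out. Qed.

Lemma dirsum_inD i : {morph @dirsum_in i : u v / u + v}.
Proof.
move=> u v; apply: dirsumP => j; rewrite dirsumDE.
have [<-|ij] := eqVneq i j; first by rewrite !dirsum_inE.
by rewrite !dirsum_in_neq ?addr0.
Qed.

Lemma dirsum_ind (P : dirsum -> Prop) :
  P 0 -> (forall a b, P a -> P b -> P (a + b)) ->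
  (forall i v, P (@dirsum_in i v)) -> forall a, P a.
Proof.
move=> P0 PD Pin a.
pose s := fset_set [set i | a i != 0]%classic.
have sE j : (j \in s) = (a j != 0).
  by rewrite in_fset_set; [apply/idP/idP; rewrite in_setE|exact: dirsum_finite].
have -> : a = \sum_(i <- s) dirsum_in (a i).
  apply: dirsumP => j; rewrite dirsum_sumE.
  have [aj0|aj0] := eqVneq (a j) 0.
    rewrite aj0 big_seq big1 // => i si; rewrite dirsum_in_neq //.
    by apply: contraTneq si => ->; rewrite sE aj0 eqxx.
  rewrite (bigD1_seq j) ?fset_uniq ?sE // dirsum_inE big1 /= ?addr0 //.
  by move=> i ij; apply: dirsum_in_neq.
by elim/big_rec: _ => // i x _ Px; apply: PD.
Qed.

End DirectSum.

Section Graded.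
Variables (V : zmodType) (F : int -> zmodClosed V).

Definition gr_piece (p : int) : zmodType := subquo (F p) (F (p - 1)).

(** [tau p x] is the class of [x] for [x \in F p], and 0 for other [x]. *)
Definition tau (p : int) (x : V) : gr_piece p := to_subquo (F p) (F (p - 1)) x.

Definition gr : zmodType := dirsum gr_piece.

(** [tau p x] seen in [gr] *)
Definition gr_in (p : int) (x : V) : gr := dirsum_in (tau p x).

Lemma gr_inE p x : gr_in p x p = tau p x.
Proof. exact: dirsum_inE. Qed.

Lemma gr_in_neq p x q : p != q -> gr_in p x q = 0.
Proof. exact: dirsum_in_neq. Qed.

Lemma gr_inB p x y : x \in F p -> y \in F p ->
  gr_in p (x - y) = gr_in p x - gr_in p y.
Proof.
move=> xF yF; rewrite /gr_in /tau to_subquoB //.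
apply: (addIr (gr_in p y)); rewrite subrK -dirsum_inD.
by rewrite subrK.
Qed.

Lemma gr_ind (P : gr -> Prop) :
  P 0 -> (forall a b, P a -> P b -> P (a + b)) ->
  (forall p x, x \in F p -> P (gr_in p x)) -> forall a, P a.
Proof.
move=> P0 PD Pin; apply: dirsum_ind => // p v.
by rewrite -(subquo_reprK v); apply: Pin; apply: subquo_reprP.
Qed.

End Graded.

(** A biadditive pairing of filtered groups induces one of the graded groups;
    this yields the ring [gr], its modules and the map [phi] below. *)
Section GradedPairing.
Variables (A B C : zmodType).
Variables (FA : int -> zmodClosed A) (FB : int -> zmodClosed B).
Variable FC : int -> zmodClosed C.

Record fpairing := FPairing {
  fpair :> A -> B -> C;
  fpairBl : forall y, zmod_morphism (fpair^~ y);
  fpairBr : forall x, zmod_morphism (fpair x);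
  fpair_fil : forall p q x y,
    x \in FA p -> y \in FB q -> fpair x y \in FC (p + q) }.

Variable f : fpairing.

Definition gr_pair_at (p n : int)
    (u : gr_piece FA p) (v : gr_piece FB (n - p)) : gr_piece FC n :=
  tau FC n (f (subquo_repr u) (subquo_repr v)).

Lemma gr_pair_atE p n x y : x \in FA p -> y \in FB (n - p) ->
  gr_pair_at (tau FA p x) (tau FB (n - p) y) = tau FC n (f x y).
Proof.
move=> xF yF; have fF z t : z \in FA p -> t \in FB (n - p) -> f z t \in FC n.
  by move=> zF tF; rewrite -(subrKC p n) fpair_fil.
rewrite /gr_pair_at; apply/eqP; rewrite eq_to_subquo ?fF ?subquo_reprP //.
set z := subquo_repr _; set t := subquo_repr _.
have zF : z \in FA p := subquo_reprP _.
have tF : t \in FB (n - p) := subquo_reprP _.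
have zx : z - x \in FA (p - 1).
  by rewrite -(eq_to_subquo (FA (p - 1)) zF xF) subquo_reprK.
have ty : t - y \in FB (n - p - 1).
  by rewrite -(eq_to_subquo (FB (n - p - 1)) tF yF) subquo_reprK.
have -> : f z t - f x y = f (z - x) t + f x (t - y).
  by rewrite fpairBl fpairBr addrA subrK.
rewrite rpredD //.
  have -> : n - 1 = (p - 1) + (n - p) by rewrite addrAC subrKC.
  exact: fpair_fil.
have -> : n - 1 = p + (n - p - 1) by rewrite addrA subrKC.
exact: fpair_fil.
Qed.

Lemma gr_pair_atDl p n (u u' : gr_piece FA p) (v : gr_piece FB (n - p)) :
  gr_pair_at (u + u') v = gr_pair_at u v + gr_pair_at u' v.
Proof.
rewrite -(subquo_reprK u) -(subquo_reprK u') -(subquo_reprK v).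
set x := subquo_repr u; set x' := subquo_repr u'; set y := subquo_repr v.
have xF : x \in FA p := subquo_reprP _.
have x'F : x' \in FA p := subquo_reprP _.
have yF : y \in FB (n - p) := subquo_reprP _.
have fF z : z \in FA p -> f z y \in FC n.
  by move=> zF; rewrite -(subrKC p n) fpair_fil.
rewrite -to_subquoD // !gr_pair_atE ?rpredD // -to_subquoD ?fF //.
have -> : x + x' = x - (0 - x') by rewrite sub0r opprK.
rewrite !(fpairBl f y) (_ : f 0 y = 0) ?sub0r ?opprK //.
by have := fpairBl f y 0 0; rewrite !subrr.
Qed.

Lemma gr_pair_atDr p n (u : gr_piece FA p) (v v' : gr_piece FB (n - p)) :
  gr_pair_at u (v + v') = gr_pair_at u v + gr_pair_at u v'.
Proof.
rewrite -(subquo_reprK u) -(subquo_reprK v) -(subquo_reprK v').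
set x := subquo_repr u; set y := subquo_repr v; set y' := subquo_repr v'.
have xF : x \in FA p := subquo_reprP _.
have yF : y \in FB (n - p) := subquo_reprP _.
have y'F : y' \in FB (n - p) := subquo_reprP _.
have fF z : z \in FB (n - p) -> f x z \in FC n.
  by move=> zF; rewrite -(subrKC p n) fpair_fil.
rewrite -to_subquoD // !gr_pair_atE ?rpredD // -to_subquoD ?fF //.
have -> : y + y' = y - (0 - y') by rewrite sub0r opprK.
rewrite !(fpairBr f x) (_ : f x 0 = 0) ?sub0r ?opprK //.
by have := fpairBr f x 0 0; rewrite !subrr.
Qed.

Lemma gr_pair_at0l p n (v : gr_piece FB (n - p)) :
  gr_pair_at (0 : gr_piece FA p) v = 0.
Proof. by apply: (addIr (gr_pair_at 0 v)); rewrite -gr_pair_atDl !add0r. Qed.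

Lemma gr_pair_at0r p n (u : gr_piece FA p) :
  gr_pair_at u (0 : gr_piece FB (n - p)) = 0.
Proof. by apply: (addIr (gr_pair_at u 0)); rewrite -gr_pair_atDr !add0r. Qed.

Definition gr_pair_fun (a : gr FA) (b : gr FB) (n : int) : gr_piece FC n :=
  \sum_(p \in [set: int]%classic) gr_pair_at (a p) (b (n - p)).

Lemma gr_pair_funE (s : seq int) (a : gr FA) (b : gr FB) n : uniq s ->
  (forall p, a p != 0 -> p \in s) ->
  gr_pair_fun a b n = \sum_(p <- s) gr_pair_at (a p) (b (n - p)).
Proof.
move=> s_uniq sP; rewrite /gr_pair_fun fsbig_supp; apply: fsbig_fwiden => //.
  move=> p /= [_ abn0]; apply: sP; apply: contra_not_neq abn0 => ->.
  exact: gr_pair_at0l.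
by move=> p /= [_ /not_andP[|/contrapT]].
Qed.

Lemma gr_pair_finite (a : gr FA) (b : gr FB) :
  finite_set [set n | gr_pair_fun a b n != 0]%classic.
Proof.
apply: (@sub_finite_set _ _
  [set p + q | p in [set p | a p != 0] & q in [set q | b q != 0]]%classic).
  move=> n /=.
  rewrite (@gr_pair_funE (fset_set [set p | a p != 0]%classic)) ?fset_uniq //.
    move=> s0; apply: contrapT => nn; move/eqP: s0; apply.
    apply: big1 => p _; have [->|ap0] := eqVneq (a p) 0.
      by rewrite gr_pair_at0l.
    have [->|bq0] := eqVneq (b (n - p)) 0; first by rewrite gr_pair_at0r.
    by case: nn; exists p => //; exists (n - p) => //; rewrite subrKC.
  by move=> p ap0; rewrite in_fset_set ?inE //; exact: dirsum_finite.
by apply: finite_image2; exact: dirsum_finite.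
Qed.

(** In degree [n] this is the sum over all [p] of the products of the
    components of degrees [p] and [n - p]. *)
Definition gr_pair (a : gr FA) (b : gr FB) : gr FC :=
  DirSum (gr_pair_finite a b).

Lemma gr_pairDl a a' b : gr_pair (a + a') b = gr_pair a b + gr_pair a' b.
Proof.
apply: dirsumP => n; rewrite dirsumDE /=.
pose s := fset_set ([set p | a p != 0] `|` [set p | a' p != 0])%classic.
have sP p : (a p != 0) || (a' p != 0) -> p \in s.
  move=> aa; rewrite in_fset_set.
    by rewrite inE /=; apply/orP.
  by rewrite finite_setU; split;
    [exact: (dirsum_finite a)|exact: (dirsum_finite a')].
rewrite !(@gr_pair_funE s) ?fset_uniq //.
- by rewrite -big_split; apply: eq_bigr => p _; rewrite dirsumDE gr_pair_atDl.
- by move=> p ap; rewrite sP // ap orbT.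
- by move=> p ap; rewrite sP // ap.
move=> p; rewrite dirsumDE => aa; apply: sP; apply: contraTT aa.
by rewrite negb_or !negbK => /andP[/eqP-> /eqP->]; rewrite addr0.
Qed.

Lemma gr_pairDr a b b' : gr_pair a (b + b') = gr_pair a b + gr_pair a b'.
Proof.
apply: dirsumP => n; rewrite dirsumDE /=.
pose s := fset_set [set p | a p != 0]%classic.
have sP p : a p != 0 -> p \in s.
  by move=> aa; rewrite in_fset_set ?inE //=; exact: dirsum_finite.
rewrite !(@gr_pair_funE s) ?fset_uniq //.
by rewrite -big_split; apply: eq_bigr => p _; rewrite dirsumDE gr_pair_atDr.
Qed.

Lemma gr_pair0l b : gr_pair 0 b = 0.
Proof. by apply: (addIr (gr_pair 0 b)); rewrite -gr_pairDl !add0r. Qed.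

Lemma gr_pair0r a : gr_pair a 0 = 0.
Proof. by apply: (addIr (gr_pair a 0)); rewrite -gr_pairDr !add0r. Qed.

Lemma gr_pair_in p q x y : x \in FA p -> y \in FB q ->
  gr_pair (gr_in FA p x) (gr_in FB q y) = gr_in FC (p + q) (f x y).
Proof.
move=> xF yF; apply: dirsumP => n.
rewrite [LHS](@gr_pair_funE [:: p]) //; last first.
  move=> r; rewrite inE; apply: contraNT => rp.
  by rewrite gr_in_neq // eq_sym.
rewrite big_seq1 gr_inE; have [qE|qn] := eqVneq q (n - p).
  move: yF; rewrite qE => yF; rewrite gr_inE gr_pair_atE //.
  by rewrite subrKC gr_inE.
rewrite gr_in_neq // gr_pair_at0r gr_in_neq //.
by apply: contra_neq qn => <-; rewrite addrC addKr.
Qed.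

End GradedPairing.

Lemma gr_pairA (A B C AB BC ABC : zmodType)
    (FA : int -> zmodClosed A) (FB : int -> zmodClosed B)
    (FC : int -> zmodClosed C) (FAB : int -> zmodClosed AB)
    (FBC : int -> zmodClosed BC) (FABC : int -> zmodClosed ABC)
    (f : fpairing FA FB FAB) (g : fpairing FAB FC FABC)
    (h : fpairing FB FC FBC) (k : fpairing FA FBC FABC) :
  (forall x y z, g (f x y) z = k x (h y z)) ->
  forall a b c, gr_pair g (gr_pair f a b) c = gr_pair k a (gr_pair h b c).
Proof.
move=> fg a b c; elim/gr_ind: a => [|a a' IH IH'|p x xF].
- by rewrite !gr_pair0l.
- by rewrite !gr_pairDl IH IH'.
elim/gr_ind: b => [|b b' IH IH'|q y yF].
- by rewrite gr_pair0l !gr_pair0r gr_pair0l.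
- by rewrite !(gr_pairDl, gr_pairDr) IH IH'.
elim/gr_ind: c => [|c c' IH IH'|r z zF].
- by rewrite !gr_pair0r.
- by rewrite !gr_pairDr IH IH'.
by rewrite !gr_pair_in ?fpair_fil // fg addrA.
Qed.

Section HomGroup.
Variables (R : pzRingType) (X Y : lmodType R).

Definition linear_pred : {pred X -> Y} := fun f => `[< linear f >].

Lemma linear_zmod_closed : zmod_closed linear_pred.
Proof.
split=> [|f g]; first by apply/asboolP=> a x y; rewrite scaler0 addr0.
move=> /asboolP fL /asboolP gL; apply/asboolP=> a x y.
by rewrite !fctE fL gL scalerBr opprD addrACA.
Qed.
HB.instance Definition _ :=
  GRing.isZmodClosed.Build (X -> Y) linear_pred linear_zmod_closed.

Definition Hom : Type := zsub linear_pred.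
HB.instance Definition _ := GRing.Zmodule.on Hom.

Definition hom_fun (f : Hom) : X -> Y := val f.

Lemma hom_linear f : linear (hom_fun f).
Proof. exact/asboolP/(valP f). Qed.
HB.instance Definition _ f :=
  GRing.isLinear.Build R X Y *:%R (hom_fun f) (hom_linear f).

Lemma mem_linear_pred (f : {linear X -> Y}) : (f : X -> Y) \in linear_pred.
Proof. by apply/asboolP; apply: linearP. Qed.

Definition to_hom (f : {linear X -> Y}) : Hom := 
  exist (fun g => g \in linear_pred) _ (mem_linear_pred f).

Lemma homP (f g : Hom) : hom_fun f =1 hom_fun g -> f = g.
Proof. by move=> fg; apply: val_inj; apply/funext. Qed.

Lemma homDE (f g : Hom) x : hom_fun (f + g) x = hom_fun f x + hom_fun g x.
Proof. by []. Qed.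

Lemma homBE (f g : Hom) x : hom_fun (f - g) x = hom_fun f x - hom_fun g x.
Proof. by []. Qed.

End HomGroup.
Coercion hom_fun : Hom >-> Funclass.

(** Right [R]-modules are left modules over the opposite ring [R^c]. *)
Section Dual.
Variables (R : pzRingType) (X : lmodType R).

Definition dual : Type := Hom X R^o.
Identity Coercion hom_of_dual : dual >-> Hom.
HB.instance Definition _ := GRing.Zmodule.on dual.

Definition dual_scale_fun (a : R^c) (f : dual) (x : X) : R^o := f x * (a : R).

Lemma dual_scale_linear a f : linear (dual_scale_fun a f).
Proof.
move=> c x y; rewrite /dual_scale_fun linearP mulrDl.
by congr (_ + _); apply/esym/mulrA.
Qed.
HB.instance Definition _ a f :=
  GRing.isLinear.Build R X R^o *:%R (dual_scale_fun a f)
    (dual_scale_linear a f).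

Definition dual_scale (a : R^c) (f : dual) : dual :=
  to_hom (dual_scale_fun a f).

Lemma dual_scaleA a b f :
  dual_scale a (dual_scale b f) = dual_scale (a * b) f.
Proof. by apply: homP => x; apply/esym; apply: mulrA. Qed.
Lemma dual_scale1 : left_id 1 dual_scale.
Proof. by move=> f; apply: homP => x; apply: mulr1. Qed.
Lemma dual_scaleDr : right_distributive dual_scale +%R.
Proof. by move=> a f g; apply: homP => x; apply: mulrDl. Qed.
Lemma dual_scaleDl f : {morph dual_scale^~ f : a b / a + b}.
Proof. by move=> a b; apply: homP => x; apply: mulrDr. Qed.
HB.instance Definition _ := GRing.Zmodule_isLmodule.Build R^c dual
  dual_scaleA dual_scale1 dual_scaleDr dual_scaleDl.

End Dual.

Section DualMap.
Variables (R : pzRingType) (X Y : lmodType R).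

Definition dual_map (f : {linear X -> Y}) (g : dual Y) : dual X :=
  to_hom (g \o f : {linear X -> R^o}).

End DualMap.

Section Bidual.
Variables (R : pzRingType) (X : lmodType R).

Definition eval_at (x : X) (f : dual X) : R^c^o := f x.

Lemma eval_at_linear x : linear (eval_at x).
Proof. by []. Qed.
HB.instance Definition _ x :=
  GRing.isLinear.Build R^c (dual X) R^c^o *:%R (eval_at x) (eval_at_linear x).

(** The bidual is a module over [R^c^c], which is [R] with its multiplication
    reversed twice. *)
Definition theta (x : X) : dual (dual X) := to_hom (eval_at x).

End Bidual.

Definition exact_at (A B C : zmodType) (f : A -> B) (g : B -> C) :=
  forall y, g y = 0 <-> exists x, f x = y.

Definition onto (A B : Type) (f : A -> B) := forall y, exists x, f x = y.

Definition projective (R : pzRingType) (P : lmodType R) :=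
  forall (A B : lmodType R) (g : {linear A -> B}) (f : {linear P -> B}),
  onto g -> exists h : {linear P -> A}, forall x, g (h x) = f x.

Record proj_resolution (R : pzRingType) (X : lmodType R) := ProjResolution {
  pr_mod :> nat -> lmodType R;
  pr_d : forall i, {linear pr_mod i.+1 -> pr_mod i};
  pr_aug : {linear pr_mod 0 -> X};
  pr_projective : forall i, projective (pr_mod i);
  pr_surj : onto pr_aug;
  pr_exact0 : exact_at (pr_d 0) pr_aug;
  pr_exact : forall i, exact_at (pr_d i.+1) (pr_d i) }.

Section FreeModule.
Variables (R : pzRingType) (T : choiceType).

Definition freeMod : Type := dirsum (fun _ : T => R : zmodType).
HB.instance Definition _ := GRing.Zmodule.on freeMod.

Implicit Types (a : R) (u v : freeMod).
Local Notation co u := (dirsum_fun (u : dirsum (fun _ : T => R : zmodType))).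

Lemma free_scale_finite a u : finite_set [set t | a * co u t != 0]%classic.
Proof.
apply: sub_finite_set (dirsum_finite u) => t /=.
by apply: contra_neq => ->; rewrite mulr0.
Qed.
Definition free_scale a u : freeMod := DirSum (free_scale_finite a u).

Lemma free_scaleA a b u : free_scale a (free_scale b u) = free_scale (a * b) u.
Proof. by apply: dirsumP => t /=; rewrite mulrA. Qed.
Lemma free_scale1 : left_id 1 free_scale.
Proof. by move=> u; apply: dirsumP => t /=; rewrite mul1r. Qed.
Lemma free_scaleDr : right_distributive free_scale +%R.
Proof. by move=> a u v; apply: dirsumP => t; apply: mulrDr. Qed.
Lemma free_scaleDl u : {morph free_scale^~ u : a b / a + b}.
Proof. by move=> a b; apply: dirsumP => t; apply: mulrDl. Qed.
HB.instance Definition _ := GRing.Zmodule_isLmodule.Build R freeMod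
  free_scaleA free_scale1 free_scaleDr free_scaleDl.

Lemma free_scaleE a u t : co (a *: u) t = a * co u t.
Proof. by []. Qed.

Definition free_gen (t : T) : freeMod := @dirsum_in T (fun=> R : zmodType) t 1.

Lemma free_ind (P : freeMod -> Prop) :
  P 0 -> (forall u v, P u -> P v -> P (u + v)) ->
  (forall a t, P (a *: free_gen t)) -> forall u, P u.
Proof.
move=> P0 PD Pg; apply: dirsum_ind => // t a.
suff -> : @dirsum_in T (fun=> R : zmodType) t a = a *: free_gen t by apply: Pg.
apply: dirsumP => s; have [<-|ts] := eqVneq t s.
  by rewrite free_scaleE !dirsum_inE mulr1.
by rewrite free_scaleE !dirsum_in_neq // mulr0.
Qed.

Variables (A : lmodType R) (g : T -> A).

Definition free_ext (u : freeMod) : A :=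
  \sum_(t <- fset_set [set t | co u t != 0]%classic) co u t *: g t.

Lemma free_extE (s : seq T) u : uniq s -> (forall t, co u t != 0 -> t \in s) ->
  free_ext u = \sum_(t <- s) co u t *: g t.
Proof.
move=> s_uniq sP; rewrite /free_ext [RHS](bigID (fun t => co u t != 0)) /=.
rewrite [X in _ + X]big1 ?addr0; last first.
  by move=> t; rewrite negbK => /eqP->; rewrite scale0r.
rewrite -[RHS]big_filter; apply: perm_big; apply: uniq_perm.
- exact: fset_uniq.
- exact: filter_uniq.
move=> t; rewrite mem_filter in_fset_set; last exact: (dirsum_finite u).
apply/idP/andP; rewrite in_setE /=; last by case.
by move=> ut; split=> //; apply: sP.
Qed.

Lemma free_ext_linear : linear free_ext.
Proof.
move=> a u v.
pose s := fset_set ([set t | co u t != 0] `|` [set t | co v t != 0])%classic.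
have sP t : (co u t != 0) || (co v t != 0) -> t \in s.
  move=> uv; rewrite in_fset_set; first by rewrite inE; apply/orP.
  by rewrite finite_setU; split;
    [apply: (dirsum_finite u)|apply: (dirsum_finite v)].
rewrite !(@free_extE s) ?fset_uniq //.
- rewrite scaler_sumr -big_split; apply: eq_bigr => t _.
  by rewrite [co _ t](_ : _ = a * co u t + co v t) // scalerDl scalerA.
- by move=> t ut; rewrite sP // ut orbT.
- by move=> t ut; rewrite sP // ut.
move=> t; rewrite [co _ t](_ : _ = a * co u t + co v t) // => uv.
apply: sP; apply: contraTT uv; rewrite negb_or !negbK.
by move=> /andP[/eqP-> /eqP->]; rewrite mulr0 addr0.
Qed.
HB.instance Definition _ :=
  GRing.isLinear.Build R freeMod A *:%R free_ext free_ext_linear.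

Lemma free_ext_gen t : free_ext (free_gen t) = g t.
Proof.
rewrite (@free_extE [:: t]) //.
  by rewrite big_seq1 /free_gen dirsum_inE scale1r.
move=> s; rewrite inE; apply: contraNT => st.
by rewrite /free_gen (@dirsum_in_neq T (fun=> R : zmodType)) // eq_sym.
Qed.

End FreeModule.

Lemma freeMod_projective (R : pzRingType) (T : choiceType) :
  projective (freeMod R T).
Proof.
move=> A B g f g_surj.
have /choice[a aE] : forall t : T, exists x, g x = f (free_gen R t).
  by move=> t; apply: g_surj.
pose h : {linear freeMod R T -> A} := free_ext a.
have hE t : h (free_gen R t) = a t := free_ext_gen a t.
exists h.
apply: free_ind => [|u v IH IH'|c t]; first by rewrite !linear0.
  by rewrite !linearD IH IH'.
by rewrite !linearZZ hE aE.
Qed.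

Section Kernel.
Variables (R : pzRingType) (A B : lmodType R) (f : {linear A -> B}).

Definition ker_pred : {pred A} := fun x => f x == 0.
Lemma ker_submod_closed : submod_closed ker_pred.
Proof.
split=> [|a x y]; rewrite /ker_pred !unfold_in ?linear0 ?eqxx //.
by move=> /eqP x0 /eqP y0; rewrite linearP x0 y0 scaler0 addr0.
Qed.
HB.instance Definition _ :=
  GRing.isSubmodClosed.Build R A ker_pred ker_submod_closed.

Definition kerMod : Type := {x : A | x \in ker_pred}.
HB.instance Definition _ := [isSub of kerMod for @sval A _].
HB.instance Definition _ := [Choice of kerMod by <:].
HB.instance Definition _ := [SubChoice_isSubLmodule of kerMod by <:].

End Kernel.

Section FreeResolution.
Variables (R : pzRingType) (X : lmodType R).

Definition free_cover (K : lmodType R) : {linear freeMod R K -> K} :=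
  free_ext (@id K).

Lemma free_cover_surj K : onto (free_cover K).
Proof. by move=> x; exists (free_gen R x); apply: free_ext_gen. Qed.

Fixpoint syzygy (n : nat) : lmodType R :=
  if n is m.+1 then kerMod (free_cover (syzygy m)) else X.

Definition free_d n :
    {linear freeMod R (syzygy n.+1) -> freeMod R (syzygy n)} :=
  val \o free_cover (syzygy n.+1).

Lemma free_d_im n y :
  free_cover (syzygy n) y = 0 <-> exists x, free_d n x = y.
Proof.
split=> [y0|[x <-]]; last exact/eqP/(valP (free_cover (syzygy n.+1) x)).
have yK : y \in ker_pred (free_cover (syzygy n)) by apply/eqP.
have [x xE] := free_cover_surj (Sub y yK : kerMod (free_cover (syzygy n))).
by exists x; rewrite /= xE.
Qed.

Lemma free_d_exact n : exact_at (free_d n.+1) (free_d n).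
Proof.
move=> y; rewrite -free_d_im.
pose v (x : kerMod (free_cover (syzygy n))) : freeMod R (syzygy n) := val x.
have v0 : v 0 = 0.
  exact: (raddf0 (val : kerMod (free_cover (syzygy n)) -> _)).
have dE : free_d n y = v (free_cover (syzygy n.+1) y) by [].
rewrite dE; split=> [y0|->] //.
by apply: val_inj; rewrite -/(v _) y0 -v0.
Qed.

Definition free_resolution : proj_resolution X :=
  @ProjResolution R X (fun n => freeMod R (syzygy n)) free_d
    (free_cover (syzygy 0)) (fun n => @freeMod_projective R (syzygy n))
    (@free_cover_surj (syzygy 0)) (@free_d_im 0) free_d_exact.

End FreeResolution.

Section Ext.
Variables (R : pzRingType) (X Y : lmodType R) (P : proj_resolution X).

Definition cocycle (k : nat) : {pred Hom (P k) Y} :=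
  fun u => `[< forall x, u (pr_d P k x) = 0 >].

Lemma cocycle_zmod_closed k : zmod_closed (@cocycle k).
Proof.
split=> [|u v]; first by apply/asboolP.
move=> /asboolP u0 /asboolP v0; apply/asboolP=> x.
by rewrite homBE u0 v0 subr0.
Qed.
HB.instance Definition _ k :=
  GRing.isZmodClosed.Build (Hom (P k) Y) (@cocycle k) (@cocycle_zmod_closed k).

Definition coboundary (k : nat) : {pred Hom (P k) Y} :=
  match k with
  | 0 => fun u => u == 0
  | j.+1 => fun u =>
      `[< exists v : Hom (P j) Y, forall x, u x = v (pr_d P j x) >]
  end.

Lemma coboundary_zmod_closed k : zmod_closed (@coboundary k).
Proof.
case: k => [|j]; split=> [|u v].
- exact: eqxx.
- by move=> /eqP-> /eqP->; rewrite subrr; apply: eqxx.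
- by apply/asboolP; exists 0.
move=> /asboolP[u' uE] /asboolP[v' vE]; apply/asboolP; exists (u' - v') => x.
by rewrite !homBE uE vE.
Qed.
HB.instance Definition _ k :=
  GRing.isZmodClosed.Build (Hom (P k) Y) (@coboundary k)
    (@coboundary_zmod_closed k).

(** [Ext^k(X, Y)], computed with the projective resolution [P] of [X] *)
Definition Ext (k : nat) : zmodType := subquo (@cocycle k) (@coboundary k).

End Ext.

(** Up to isomorphism [Ext Y P k] does not depend on [P], and such a [P] exists
    for every [X] by [free_resolution]. *)
Definition Ext_eq0 (R : pzRingType) (k : nat) (X Y : lmodType R) :=
  forall (P : proj_resolution X) (u : Ext Y P k), u = 0.

Definition Gdim0 (R : pzRingType) (X : lmodType R) :=
  [/\ bijective (@theta R X),
      forall k, (0 < k)%N -> Ext_eq0 k X R^o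
    & forall k, (0 < k)%N -> Ext_eq0 k (dual X) R^c^o].

(** All left ideals are finitely generated. *)
Definition noetherian (R : pzRingType) :=
  forall I : {pred R^o}, submod_closed I ->
  exists (r : nat) (g : 'I_r -> R), forall x,
    x \in I <-> exists c : 'I_r -> R, x = \sum_k c k * g k.

(** The filtration is indexed by all integers, with [rfil p = 0] for [p < 0];
    hence the summands of negative degree of [grR] below vanish. *)
Record filtRing := FiltRing {
  fring :> pzRingType;
  rfil : int -> zmodClosed fring;
  rfil1 : 1 \in rfil 0;
  rfil_neg : forall p x, p < 0 -> x \in rfil p -> x = 0;
  rfilS : forall p x, x \in rfil p -> x \in rfil (p + 1);
  rfilM : forall p q x y,
    x \in rfil p -> y \in rfil q -> x * y \in rfil (p + q);
  rfilU : forall x, exists p, x \in rfil p }.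

(** Modules with an increasing family of subgroups compatible with that of the
    ring. The other axioms of a filtration are in [is_filtration]; for a dual
    module they only hold under a finiteness condition. *)
Record prefiltMod (L : filtRing) := PrefiltMod {
  fmod :> lmodType L;
  mfil : int -> zmodClosed fmod;
  mfilS : forall p x, x \in mfil p -> x \in mfil (p + 1);
  mfilZ : forall p q (a : L) x,
    a \in rfil L p -> x \in mfil q -> a *: x \in mfil (p + q) }.

Definition is_filtration (L : filtRing) (M : prefiltMod L) :=
  (exists p0, forall p x, p < p0 -> x \in mfil M p -> x = 0) /\
  (forall x, exists p, x \in mfil M p).

Definition good_filtration (L : filtRing) (M : prefiltMod L) :=
  exists (r : nat) (d : 'I_r -> int) (m : 'I_r -> M), forall p x,
    x \in mfil M p <-> exists2 c : 'I_r -> L,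
      forall k, c k \in rfil L (p - d k) & x = \sum_k c k *: m k.

Section Opposite.
Variable L : filtRing.

Lemma opp_rfilM p q (x y : L^c) :
  x \in rfil L p -> y \in rfil L q -> x * y \in rfil L (p + q).
Proof. by move=> xF yF; rewrite addrC; apply: rfilM. Qed.

Definition fopp : filtRing :=
  @FiltRing L^c (rfil L) (rfil1 L) (@rfil_neg L) (@rfilS L)
    opp_rfilM (@rfilU L).

End Opposite.

Section FilteredDual.
Variables (L : filtRing) (X : prefiltMod L).

Definition dual_fil (p : int) : {pred dual X} :=
  fun f => `[< forall q x, x \in mfil X q -> f x \in rfil L (p + q) >].

Lemma dual_fil_zmod_closed p : zmod_closed (dual_fil p).
Proof.
split=> [|f g]; first by apply/asboolP=> q x _; apply: rpred0.
move=> /asboolP fF /asboolP gF; apply/asboolP=> q x xF.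
by apply: rpredB; [apply: fF|apply: gF].
Qed.
HB.instance Definition _ p :=
  GRing.isZmodClosed.Build (dual X) (dual_fil p) (dual_fil_zmod_closed p).

Lemma dual_filS p f : f \in dual_fil p -> f \in dual_fil (p + 1).
Proof.
by move=> /asboolP fF; apply/asboolP=> q x xF; rewrite addrAC rfilS ?fF.
Qed.

Lemma dual_filZ p q (a : fopp L) (f : dual X) :
  a \in rfil (fopp L) p -> f \in dual_fil q -> a *: f \in dual_fil (p + q).
Proof.
move=> aF /asboolP fF; apply/asboolP=> r x xF.
by rewrite -addrA addrC; apply: rfilM; [apply: fF|].
Qed.

Definition fdual : prefiltMod (fopp L) :=
  @PrefiltMod (fopp L) (dual X) dual_fil dual_filS dual_filZ.

End FilteredDual.

Section FilteredMaps.
Variables (L L' : filtRing) (X : prefiltMod L) (Y : prefiltMod L').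

Definition filtered (f : X -> Y) :=
  forall p x, x \in mfil X p -> f x \in mfil Y p.

Definition strict (f : X -> Y) := forall p y,
  (exists2 x, x \in mfil X p & f x = y) <->
  ((exists x, f x = y) /\ y \in mfil Y p).

End FilteredMaps.

Definition filtered_free (L : filtRing) (F : prefiltMod L) :=
  exists (r : nat) (e : 'I_r -> F) (d : 'I_r -> int),
    (forall x, exists! c : 'I_r -> L, x = \sum_k c k *: e k) /\
    (forall p x, x \in mfil F p <-> exists2 c : 'I_r -> L,
       forall k, c k \in rfil L (p - d k) & x = \sum_k c k *: e k).

Record ff_resolution (L : filtRing) (N : prefiltMod L) := FFResolution {
  ff_mod :> nat -> prefiltMod L;
  ff_d : forall i, {linear ff_mod i.+1 -> ff_mod i};
  ff_aug : {linear ff_mod 0 -> N};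
  ff_free : forall i, filtered_free (ff_mod i);
  ff_d_strict : forall i, filtered (ff_d i) /\ strict (ff_d i);
  ff_aug_strict : filtered ff_aug /\ strict ff_aug;
  ff_surj : onto ff_aug;
  ff_exact0 : exact_at (ff_d 0) ff_aug;
  ff_exact : forall i, exact_at (ff_d i.+1) (ff_d i) }.

(** The map [ff_d F i] is the one from the term of index [i.+1], so the
    augmentation is excluded here. *)
Definition strict_dual_resolutions (L : filtRing) (N : prefiltMod L) :=
  forall (F : ff_resolution N) (i : nat),
  @strict (fopp L) (fopp L) (fdual (F i)) (fdual (F i.+1))
    (dual_map (ff_d F i)).

Section GradedRing.
Variable L : filtRing.

Lemma rmulBl (y : L) : zmod_morphism ( *%R^~ y).
Proof. by move=> a b; apply: mulrBl. Qed.
Lemma rmulBr (x : L) : zmod_morphism ( *%R x).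
Proof. by move=> a b; apply: mulrBr. Qed.
Definition rmul_pairing : fpairing (rfil L) (rfil L) (rfil L) :=
  FPairing rmulBl rmulBr (@rfilM L).

Definition grR : Type := gr (rfil L).
HB.instance Definition _ := GRing.Zmodule.on grR.

Definition grR1 : grR := gr_in (rfil L) 0 1.
Definition grR_mul (a b : grR) : grR := gr_pair rmul_pairing a b.

Lemma grR_mulA : associative grR_mul.
Proof. by move=> a b c; apply/esym/gr_pairA => x y z; apply/esym/mulrA. Qed.
Lemma grR_mul1l : left_id grR1 grR_mul.
Proof.
elim/gr_ind => [|a b IH IH'|p x xF]; rewrite /grR_mul ?gr_pair0r //.
  by rewrite gr_pairDr; congr (_ + _).
by rewrite gr_pair_in ?rfil1 // add0r /= mul1r.
Qed.
Lemma grR_mul1r : right_id grR1 grR_mul.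
Proof.
elim/gr_ind => [|a b IH IH'|p x xF]; rewrite /grR_mul ?gr_pair0l //.
  by rewrite gr_pairDl; congr (_ + _).
by rewrite gr_pair_in ?rfil1 // addr0 /= mulr1.
Qed.
Lemma grR_mulDl : left_distributive grR_mul +%R.
Proof. by move=> a b c; apply: gr_pairDl. Qed.
Lemma grR_mulDr : right_distributive grR_mul +%R.
Proof. by move=> a b c; apply: gr_pairDr. Qed.
HB.instance Definition _ := GRing.Zmodule_isPzRing.Build grR
  grR_mulA grR_mul1l grR_mul1r grR_mulDl grR_mulDr.

Variable M : prefiltMod L.

Lemma mscaleBl (x : M) : zmod_morphism (fun a : L => a *: x).
Proof. by move=> a b; apply: scalerBl. Qed.
Lemma mscaleBr (a : L) : zmod_morphism (fun x : M => a *: x).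
Proof. by move=> x y; apply: scalerBr. Qed.
Definition mscale_pairing : fpairing (rfil L) (mfil M) (mfil M) :=
  FPairing mscaleBl mscaleBr (@mfilZ L M).

Definition grM : Type := gr (mfil M).
HB.instance Definition _ := GRing.Zmodule.on grM.

Definition grM_scale (a : grR) (x : grM) : grM := gr_pair mscale_pairing a x.

Lemma grM_scaleA a b x : grM_scale a (grM_scale b x) = grM_scale (a * b) x.
Proof. by apply/esym/gr_pairA => y z t; apply/esym/scalerA. Qed.
Lemma grM_scale1 : left_id 1 grM_scale.
Proof.
elim/gr_ind => [|a b IH IH'|p x xF]; rewrite /grM_scale ?gr_pair0r //.
  by rewrite gr_pairDr; congr (_ + _).
by rewrite gr_pair_in ?rfil1 // add0r /= scale1r.
Qed.
Lemma grM_scaleDr : right_distributive grM_scale +%R.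
Proof. by move=> a x y; apply: gr_pairDr. Qed.
Lemma grM_scaleDl x : {morph grM_scale^~ x : a b / a + b}.
Proof. by move=> a b; apply: gr_pairDl. Qed.
HB.instance Definition _ := GRing.Zmodule_isLmodule.Build grR grM
  grM_scaleA grM_scale1 grM_scaleDr grM_scaleDl.

End GradedRing.

Section Phi.
Variables (L : filtRing) (X : prefiltMod L).

Lemma evalBl (f : dual X) : zmod_morphism (fun x : X => f x : L).
Proof. by move=> x y; apply: (raddfB f). Qed.
Lemma evalBr (x : X) : zmod_morphism (fun f : dual X => f x : L).
Proof. by []. Qed.
Lemma eval_fil p q (x : X) (f : dual X) :
  x \in mfil X p -> f \in mfil (fdual X) q -> f x \in rfil L (p + q).
Proof. by move=> xF /asboolP fF; rewrite addrC; apply: fF. Qed.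
Definition eval_pairing : fpairing (mfil X) (mfil (fdual X)) (rfil L) :=
  FPairing evalBl evalBr eval_fil.

Definition phi_fun (u : grM (fdual X)) (x : grM X) : (grR L)^o :=
  gr_pair eval_pairing x u.

Lemma phi_fun_linear u : linear (phi_fun u).
Proof.
move=> a x y; rewrite /phi_fun gr_pairDl; congr (_ + _).
by apply: gr_pairA => c z f; apply: (linearZZ (hom_fun f)).
Qed.
HB.instance Definition _ u := GRing.isLinear.Build (grR L) (grM X) (grR L)^o
  *:%R (phi_fun u) (phi_fun_linear u).

Definition phi (u : grM (fdual X)) : dual (grM X) := to_hom (phi_fun u).

Lemma phi_tau p q (f : dual X) (x : X) :
  f \in mfil (fdual X) p -> x \in mfil X q ->
  phi (gr_in (mfil (fdual X)) p f) (gr_in (mfil X) q x)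
    = gr_in (rfil L) (p + q) (f x).
Proof. by move=> fF xF; rewrite addrC; apply: gr_pair_in. Qed.

Lemma phi_zmod_morphism : zmod_morphism phi.
Proof.
move=> u v; apply: homP => x; rewrite [RHS]homBE.
have phiE w : hom_fun (phi w) x = gr_pair eval_pairing x w by [].
by rewrite !phiE; apply/eqP; rewrite eq_sym subr_eq -gr_pairDr subrK.
Qed.

(** [gr] of the opposite ring and the opposite ring of [gr] have the same
    elements, so scalars can be compared. *)
Definition grR_fopp (a : grR (fopp L)) : (grR L)^c := a.

Lemma phiZ (a : grR (fopp L)) (u : grM (fdual X)) :
  phi (a *: u) = grR_fopp a *: phi u.
Proof.
apply: homP => x.
have -> : hom_fun (phi (a *: u)) x
    = gr_pair eval_pairing x (gr_pair (mscale_pairing (fdual X)) a u) by [].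
have -> : hom_fun (grR_fopp a *: phi u) x
    = gr_pair (rmul_pairing L) (gr_pair eval_pairing x u) (grR_fopp a) by [].
elim/gr_ind: x => [|x x' IH IH'|p x xF].
- by rewrite !gr_pair0l.
- by rewrite !gr_pairDl IH IH'.
elim/gr_ind: u => [|u u' IH IH'|q f fF].
- by rewrite !gr_pair0r gr_pair0l.
- by rewrite !(gr_pairDl, gr_pairDr) IH IH'.
rewrite /grR_fopp; elim/gr_ind: a => [|a a' IH IH'|r a aF].
- by rewrite gr_pair0l !gr_pair0r.
- by rewrite gr_pairDl !gr_pairDr IH IH'.
rewrite gr_pair_in // gr_pair_in //; last first.
  exact: (fpair_fil (mscale_pairing (fdual X))).
rewrite gr_pair_in // [RHS]gr_pair_in //; last exact: (fpair_fil eval_pairing).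
by rewrite addrA addrAC.
Qed.

End Phi.

(* Main.v *)
From HB Require Import structures.
From mathcomp Require Import all_boot all_order all_algebra.
From mathcomp Require Import boolp classical_sets cardinality.
From mathcomp Require Import zify.
Require Import Defs.

(** The associated graded of a complex of filtered groups is exact at a term
    (whose filtration is bounded below and exhaustive) if and only if every
    cycle in [F_p] is the boundary of an element of [F_p] and the outgoing map
    is strict. For a filtered free resolution [F]
    of [N], the complex [gr F] is a free resolution of [gr N], and its dual is
    [gr] of the dual complex of [F], because [phi] is an isomorphism for
    filtered free modules. Hence [Ext^k(gr N, gr L)] vanishes for all [k > 0]
    if and only if all [Ext^k(N, L)] vanish and the maps dual to those of [F]
    are strict; in that case [phi_N] is an isomorphism. This is applied to
    [N = M] and to [N = M^*]. Finally [phi_(M^* )] composed with [gr theta_M] is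
    [theta_(gr M)] followed by the dual of [phi_M], so [theta_(gr M)] is
    bijective if and only if [theta_M] is bijective and strict. *)

Set Implicit Arguments.
Unset Strict Implicit.
Unset Printing Implicit Defensive.

Import GRing.Theory.
Local Open Scope ring_scope.

(** The rings [grR (fopp L)] and [(grR L)^c] have the same elements, but their
    multiplications are not convertible. As rings they are equal, which allows
    [Ext_eq0] to be transported between them. *)
Section RingEquality.
Variable V : zmodType.

(** The additive group is fixed and only the multiplicative structure varies, so equality of two
    rings on [V] reduces to equality of units and products. *)
Definition pzring_of (m : GRing.Nmodule_isPzSemiRing V) : pzRingType :=
  GRing.PzRing.Pack (GRing.PzRing.Class
    (Algebra.Zmodule.Algebra_BaseZmoduleNmodule_isZmodule_mixin
       (Algebra.Zmodule.class V)) m).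

Lemma pzring_of_eq (m m' : GRing.Nmodule_isPzSemiRing V) :
  GRing.Nmodule_isPzSemiRing.one m = GRing.Nmodule_isPzSemiRing.one m' ->
  GRing.Nmodule_isPzSemiRing.mul m = GRing.Nmodule_isPzSemiRing.mul m' ->
  pzring_of m = pzring_of m'.
Proof.
case: m m' => [o m ? ? ? ? ? ? ?] [o' m' ? ? ? ? ? ? ?] /= oo' mm'.
subst o' m'.
congr (pzring_of (GRing.Nmodule_isPzSemiRing.Axioms_ _ _ _ _ _ _ _ _ _));
  exact: Prop_irrelevance.
Qed.

End RingEquality.

Definition ring_cast (R S : pzRingType) (e : R = S) : R -> S :=
  fun a => eq_rect R (fun T : pzRingType => T) a S e.

Lemma grR_fopp_mul (L : filtRing) (a b : grR L) :
  (a : grR (fopp L)) * (b : grR (fopp L)) = b * a :> grR L.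
Proof.
rewrite -[LHS]/(gr_pair (rmul_pairing (fopp L)) a b).
rewrite -[RHS]/(gr_pair (rmul_pairing L) b a).
elim/gr_ind: a => [|a a' IH IH'|p x xF].
- by rewrite gr_pair0l gr_pair0r.
- by rewrite gr_pairDl gr_pairDr; congr (_ + _).
elim/gr_ind: b => [|b b' IH IH'|q y yF].
- by rewrite gr_pair0l gr_pair0r.
- by rewrite gr_pairDl gr_pairDr; congr (_ + _).
by rewrite !gr_pair_in // addrC.
Qed.

Lemma grR_foppE (L : filtRing) : grR (fopp L) = (grR L)^c%type :> pzRingType.
Proof.
apply: (@pzring_of_eq (gr (rfil L))
  (GRing.PzRing.class (grR (fopp L) : pzRingType))
  (GRing.PzRing.class ((grR L)^c%type : pzRingType))) => //.
by apply/funext => a; apply/funext => b; apply: grR_fopp_mul.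
Qed.

(** The cast depends only on the equality of carriers induced by [e]. As the carriers are
    convertible, proof irrelevance makes that equality reflexivity. *)
Lemma grR_fopp_cast (L : filtRing)
    (e : grR (fopp L) = (grR L)^c%type :> pzRingType) (a : grR (fopp L)) :
  ring_cast e a = a.
Proof.
have castE (R S : pzRingType) (f : R = S) (x : R) :
    ring_cast f x = eq_rect _ id x _ (f_equal GRing.PzRing.sort f).
  by case: _ / f.
have idE (T : Type) (f : T = T) (x : T) : eq_rect T id x T f = x.
  by rewrite (Prop_irrelevance f erefl).
by rewrite castE; apply: (idE (gr (rfil L))).
Qed.

(** Carries the Noetherian hypothesis over to the graded ring that acts on the dual modules. *)
Lemma grR_comm_fopp (L : filtRing) : (forall a b : grR L, a * b = b * a) ->
  grR L = grR (fopp L) :> pzRingType.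
Proof.
move=> C.
apply: (@pzring_of_eq (gr (rfil L))
  (GRing.PzRing.class (grR L : pzRingType))
  (GRing.PzRing.class (grR (fopp L) : pzRingType))) => //.
apply/funext => a; apply/funext => b.
by rewrite -[LHS]/((a : grR L) * (b : grR L)) C; apply/esym/grR_fopp_mul.
Qed.

(** * Independence of Ext from the resolution *)

Section ZmodMorphism.
Variables (V W : zmodType) (f : V -> W).
Hypothesis fB : zmod_morphism f.

Lemma zmod_morphism0 : f 0 = 0.
Proof. by rewrite -(subrr 0) fB subrr. Qed.

Lemma zmod_morphismN x : f (- x) = - f x.
Proof. by rewrite -sub0r fB zmod_morphism0 sub0r. Qed.

Lemma zmod_morphismD x y : f (x + y) = f x + f y.
Proof. by rewrite -{1}[y]opprK fB zmod_morphismN opprK. Qed.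

End ZmodMorphism.

Definition linear_of (R : pzRingType) (A B : lmodType R) (f : A -> B)
    (fL : linear f) : {linear A -> B} :=
  HB.pack f (GRing.isLinear.Build R A B *:%R f fL).

Section Comparison.
Variable R : pzRingType.

Lemma chain_choice (T : nat -> Type) (Q : forall i, T i -> T i.+1 -> Prop)
    (x0 : T 0%N) :
  (exists x1, Q 0%N x0 x1) ->
  (forall i x y, Q i x y -> exists z, Q i.+1 y z) ->
  exists2 a : forall i, T i, a 0%N = x0 & forall i, Q i (a i) (a i.+1).
Proof.
move=> /cid[x1 Q0] QS.
(* The recursion carries two consecutive terms with their relation, because that relation is the
   premise of the next extension. *)
pose S i := {xy : T i * T i.+1 | Q i xy.1 xy.2}.
have next i (s : S i) : {z : T i.+2 | Q i.+1 (sval s).2 z}.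
  by apply: cid; apply: QS (svalP s).
pose st := fix st i : S i := if i is j.+1 then
    let s := st j in
    exist (fun xy => Q j.+1 xy.1 xy.2)
      ((sval s).2, sval (next j s)) (svalP (next j s))
  else exist (fun xy => Q 0%N xy.1 xy.2) (x0, x1) Q0.
exists (fun i => (sval (st i)).1) => // i.
exact: (svalP (st i)).
Qed.

(** Corestricted to the kernel of [h], the map [g] becomes onto and [f] still makes sense, so
    projectivity applies. *)
Lemma projective_lift (P A B C : lmodType R) (f : {linear P -> B})
    (g : {linear A -> B}) (h : {linear B -> C}) :
  projective P -> exact_at g h -> (forall x, h (f x) = 0) ->
  exists l : {linear P -> A}, forall x, g (l x) = f x.
Proof.
move=> projP ex hf.
have fK x : f x \in ker_pred h by apply/eqP.
have gK x : g x \in ker_pred h by apply/eqP/ex; exists x.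
pose f' x : kerMod h := Sub (f x) (fK x).
pose g' x : kerMod h := Sub (g x) (gK x).
have f'L : linear f' by move=> a x y; apply: val_inj; rewrite /= !linearP.
have g'L : linear g' by move=> a x y; apply: val_inj; rewrite /= !linearP.
pose fl := linear_of f'L; pose gl := linear_of g'L.
have gS : onto gl.
  move=> y; have /eqP/ex[x xE] : h (val y) == 0 := valP y.
  by exists x; apply: val_inj.
have [l lE] := projP _ _ gl fl gS.
by exists l => x; have := congr1 val (lE x).
Qed.

Lemma chain_map (X : lmodType R) (P Q : proj_resolution X) :
  exists a : forall i, {linear P i -> Q i},
    (forall x, pr_aug Q (a 0%N x) = pr_aug P x) /\
    (forall i x, pr_d Q i (a i.+1 x) = a i (pr_d P i x)).
Proof.
have [a0 a0E] := pr_projective (p := P) (pr_aug P) (pr_surj Q).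
pose T i := {linear P i -> Q i}.
pose S i (a : T i) (b : T i.+1) := forall x, pr_d Q i (b x) = a (pr_d P i x).
have [] := @chain_choice T S a0.
- have [|l lE] := projective_lift (f := a0 \o pr_d P 0%N)
    (pr_projective (p := P) (i := 1)) (pr_exact0 (p := Q)).
    by move=> x /=; rewrite a0E; apply/(pr_exact0 (p := P)); exists x.
  by exists l.
- move=> i a b ab.
  have [|l lE] := projective_lift (f := b \o pr_d P i.+1)
      (pr_projective (p := P) (i := i.+2)) (pr_exact (p := Q) (i := i)).
    move=> x /=; rewrite ab.
    have -> : pr_d P i (pr_d P i.+1 x) = 0.
      by apply/(pr_exact (p := P)); exists x.
    exact: linear0.
  by exists l.
by move=> a a0' aE; exists a; rewrite a0'.
Qed.

(** Applied to the composite [Q -> P -> Q] of two comparison maps. In each degree the error left by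
    the previous term of the homotopy is a cycle, hence lifts through the next differential. *)
Lemma chain_homotopy (X : lmodType R) (Q : proj_resolution X)
    (c : forall i, {linear Q i -> Q i}) :
  (forall x, pr_aug Q (c 0%N x) = pr_aug Q x) ->
  (forall i x, pr_d Q i (c i.+1 x) = c i (pr_d Q i x)) ->
  exists h : forall i, {linear Q i -> Q i.+1}, forall i x,
    c i.+1 x - x = pr_d Q i.+1 (h i.+1 x) + h i (pr_d Q i x).
Proof.
move=> c0 cS; have dd i x : pr_d Q i (pr_d Q i.+1 x) = 0.
  by apply/(pr_exact (p := Q)); exists x.
have dB i x y : pr_d Q i (x - y) = pr_d Q i x - pr_d Q i y by exact: linearB.
(* In degree 0 the error [c 0 - id] is killed by the augmentation, so it lifts through
   [pr_d Q 0]. *)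
have [|h0 h0E] := projective_lift (f := c 0%N \- idfun)
  (pr_projective (p := Q) (i := 0%N)) (pr_exact0 (p := Q)).
  by move=> x /=; rewrite linearB c0 subrr.
pose T i := {linear Q i -> Q i.+1}.
pose S i (a : T i) (b : T i.+1) := forall x,
  c i.+1 x - x = pr_d Q i.+1 (b x) + a (pr_d Q i x).
have lift i (a : T i) :
    (forall x, pr_d Q i (a (pr_d Q i x)) = c i (pr_d Q i x) - pr_d Q i x) ->
    exists b, S i a b.
  move=> aE.
  have [|l lE] := projective_lift (f := c i.+1 \- idfun \- (a \o pr_d Q i))
      (pr_projective (p := Q) (i := i.+1)) (pr_exact (p := Q) (i := i)).
    move=> x; rewrite -[LHS]/(pr_d Q i (c i.+1 x - x - a (pr_d Q i x))).
    by rewrite !dB cS aE subrr.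
  by exists l => x; rewrite lE /= subrK.
have [|i a b ab|h _ hE] := @chain_choice T S h0; last by exists h.
- by apply: lift => x; rewrite h0E.
- apply: lift => x.
  by have := ab (pr_d Q i.+1 x); rewrite dd (linear0 a) addr0 => <-.
Qed.

(** Vanishing of [Ext^(i+1)] expressed on cocycles, without the quotient. *)
Definition dual_exact (X Y : lmodType R) (P : proj_resolution X) (i : nat) :=
  forall u : Hom (P i.+1) Y, (forall x, u (pr_d P i.+1 x) = 0) ->
  exists v : Hom (P i) Y, forall x, u x = v (pr_d P i x).

Lemma Ext_zeroP (X Y : lmodType R) (P : proj_resolution X) i :
  (forall u : Ext Y P i.+1, u = 0) <-> dual_exact Y P i.
Proof.
split=> [E u u0|E u].
  have uC : u \in @cocycle R X Y P i.+1 by apply/asboolP.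
  have /eqP := E (to_subquo (@cocycle R X Y P i.+1) (@coboundary R X Y P i.+1)
    u).
  by rewrite to_subquo_eq0 // => /asboolP.
rewrite -(subquo_reprK u); apply/eqP; rewrite to_subquo_eq0 ?subquo_reprP //.
apply/asboolP; apply: E; have /asboolP := subquo_reprP u; apply.
Qed.

(** Pulled back to [P], the cocycle [u] becomes a coboundary. Pulling back further to [Q] changes
    [u] only by the term [u \o h] of the homotopy, which is again a coboundary. *)
Lemma dual_exact_indep (X Y : lmodType R) (P Q : proj_resolution X) i :
  dual_exact Y P i -> dual_exact Y Q i.
Proof.
move=> E u u0.
have [a [a0 aS]] := chain_map P Q.
have [b [b0 bS]] := chain_map Q P.
have [||h hE] := @chain_homotopy X Q (fun i => a i \o b i).
- by move=> x /=; rewrite a0 b0.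
- by move=> j x /=; rewrite aS bS.
have [|v vE] := E (to_hom (u \o a i.+1)).
  by move=> x; rewrite -[LHS]/(u (a i.+1 (pr_d P i.+1 x))) -aS u0.
have uB y z : u (y - z) = u y - u z by exact: linearB.
have uD y z : u (y + z) = u y + u z by exact: linearD.
exists (to_hom ((v \o b i) \- (u \o h i))) => x.
rewrite -[RHS]/(v (b i (pr_d Q i x)) - u (h i (pr_d Q i x))) -bS -vE.
have := congr1 u (hE i x); rewrite uB uD u0 add0r => <-.
by rewrite opprB addrC subrK.
Qed.

(** [Ext_eq0] quantifies over all resolutions; by independence it can be tested on a single one, for
    all degrees at once. *)
Lemma Ext_eq0P (X Y : lmodType R) (P : proj_resolution X) :
  (forall k, (0 < k)%N -> Ext_eq0 k X Y) <-> forall i, dual_exact Y P i.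
Proof.
split=> [E i|E [|i] // _ Q]; first by apply/Ext_zeroP/E.
by apply/Ext_zeroP; apply: dual_exact_indep (E i).
Qed.

End Comparison.

(** Once [e] is reduced to reflexivity, [f] is a linear isomorphism. Composing the augmentation of a
    resolution of [Y] with its inverse resolves [X] by the same complex. *)
Lemma Ext_eq0_transfer (R S : pzRingType) (e : R = S)
    (X : lmodType R) (Y : lmodType S) (f : X -> Y) :
  bijective f -> zmod_morphism f ->
  (forall a x, f (a *: x) = ring_cast e a *: f x) ->
  (forall k, (0 < k)%N -> Ext_eq0 k X R^o) <->
  (forall k, (0 < k)%N -> Ext_eq0 k Y S^o).
Proof.
case: _ / e Y f => Y f [g fK gK] fB fZ.
have fL : linear f by move=> a x y; rewrite (zmod_morphismD fB) fZ.
have gL : linear g by move=> a x y; apply: (can_inj fK); rewrite fL !gK.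
pose gl := linear_of gL.
pose P := free_resolution Y.
have onto_g : onto (gl \o pr_aug P).
  by move=> x; have [y yE] := pr_surj P (f x); exists y; rewrite /= yE fK.
have ex_g : exact_at (pr_d P 0%N) (gl \o pr_aug P).
  move=> y; rewrite -(pr_exact0 (p := P)) /=.
  split=> [E|->]; last exact: linear0 gl.
  by apply: (can_inj gK); rewrite E; apply/esym/(linear0 gl).
pose P' : proj_resolution X :=
  @ProjResolution R X P (pr_d P) (gl \o pr_aug P) (@pr_projective _ _ P)
    onto_g ex_g (@pr_exact _ _ P).
by rewrite (Ext_eq0P R^o P) (Ext_eq0P R^o P').
Qed.

(** * Graded maps and exactness *)

Section GradedPieces.
Variables (V : zmodType) (F : int -> zmodClosed V).

Lemma tau_eq0 p x : x \in F p -> (tau F p x == 0) = (x \in F (p - 1)).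
Proof. exact: to_subquo_eq0. Qed.

Lemma tau0 p : tau F p 0 = 0.
Proof. exact: to_subquo0. Qed.

Lemma tauD p x y : x \in F p -> y \in F p ->
  tau F p (x + y) = tau F p x + tau F p y.
Proof. exact: to_subquoD. Qed.

Lemma eq_tau p x y : x \in F p -> y \in F p ->
  (tau F p x == tau F p y) = (x - y \in F (p - 1)).
Proof. exact: eq_to_subquo. Qed.

Lemma gr_pieceP p (u : gr_piece F p) : exists2 x, x \in F p & u = tau F p x.
Proof.
by exists (subquo_repr u); [exact: subquo_reprP|rewrite /tau subquo_reprK].
Qed.

Lemma gr_in0 p : gr_in F p 0 = 0.
Proof.
apply: dirsumP => q; have [<-|pq] := eqVneq p q; first by rewrite gr_inE tau0.
by rewrite gr_in_neq.
Qed.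

Lemma gr_inD p x y : x \in F p -> y \in F p ->
  gr_in F p (x + y) = gr_in F p x + gr_in F p y.
Proof. by move=> xF yF; rewrite /gr_in tauD // dirsum_inD. Qed.

Lemma gr_in_sum p (I : Type) (s : seq I) (x : I -> V) :
  (forall i, x i \in F p) ->
  gr_in F p (\sum_(i <- s) x i) = \sum_(i <- s) gr_in F p (x i).
Proof.
move=> xF; elim: s => [|i s IH]; first by rewrite !big_nil gr_in0.
by rewrite !big_cons gr_inD ?rpred_sum // IH.
Qed.

End GradedPieces.

Section GradedMap.
Variables (V W : zmodType) (F : int -> zmodClosed V) (G : int -> zmodClosed W).

(** Only additivity is asked: this also covers [theta], whose source and target are modules over [L]
    and over its double opposite. *)
Record fmorph := FMorph {
  fmorph_fun :> V -> W;
  fmorphB : zmod_morphism fmorph_fun;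
  fmorph_fil : forall p x, x \in F p -> fmorph_fun x \in G p }.

Lemma fmorph0 (f : fmorph) : f 0 = 0.
Proof. exact: zmod_morphism0 (fmorphB f). Qed.

Lemma fmorphD (f : fmorph) x y : f (x + y) = f x + f y.
Proof. exact: zmod_morphismD (fmorphB f) x y. Qed.

Variable f : fmorph.

Definition gr_map_at p (u : gr_piece F p) : gr_piece G p :=
  tau G p (f (subquo_repr u)).

Lemma gr_map_atE p x : x \in F p -> gr_map_at (tau F p x) = tau G p (f x).
Proof.
move=> xF; have rF : subquo_repr (tau F p x) \in F p := subquo_reprP _.
apply/eqP; rewrite /gr_map_at eq_tau ?fmorph_fil // -fmorphB fmorph_fil //.
by rewrite -eq_tau // /tau subquo_reprK.
Qed.

Lemma gr_map_at0 p : gr_map_at (0 : gr_piece F p) = 0.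
Proof. by rewrite -tau0 gr_map_atE ?rpred0 // fmorph0 tau0. Qed.

Lemma gr_map_finite (u : gr F) :
  finite_set [set p | gr_map_at (u p) != 0]%classic.
Proof.
apply: sub_finite_set (dirsum_finite u) => p /=.
by apply: contra_neq => ->; apply: gr_map_at0.
Qed.

Definition gr_map (u : gr F) : gr G := DirSum (gr_map_finite u).

Lemma gr_mapE u p : gr_map u p = gr_map_at (u p).
Proof. by []. Qed.

Lemma gr_map_in p x : x \in F p -> gr_map (gr_in F p x) = gr_in G p (f x).
Proof.
move=> xF; apply: dirsumP => q; rewrite gr_mapE; have [<-|pq] := eqVneq p q.
  by rewrite !gr_inE gr_map_atE.
by rewrite !gr_in_neq // gr_map_at0.
Qed.

Lemma gr_mapD u v : gr_map (u + v) = gr_map u + gr_map v.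
Proof.
apply: dirsumP => p; rewrite gr_mapE !dirsumDE !gr_mapE.
have [x xF ->] := gr_pieceP (u p); have [y yF ->] := gr_pieceP (v p).
by rewrite -tauD // !gr_map_atE ?rpredD // fmorphD tauD ?fmorph_fil.
Qed.

Lemma gr_map0 : gr_map 0 = 0.
Proof. by apply: (addIr (gr_map 0)); rewrite -gr_mapD !add0r. Qed.

End GradedMap.

Section GradedExactness.
Variables (A B C : zmodType) (FA : int -> zmodClosed A).
Variables (FB : int -> zmodClosed B) (FC : int -> zmodClosed C).

(** Exactness of the graded complex at the middle term, expressed on representatives: a homogeneous
    class killed by [gr g] is the image of a class of the same degree. *)
Definition gr_exact (f : A -> B) (g : B -> C) := forall p y,
  y \in FB p -> g y \in FC (p - 1) ->
  exists2 x, x \in FA p & y - f x \in FB (p - 1).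

Lemma gr_map_comp0 (f : fmorph FA FB) (g : fmorph FB FC) :
  (forall x, g (f x) = 0) -> forall u, gr_map g (gr_map f u) = 0.
Proof.
move=> gf u; apply: dirsumP => p; rewrite !gr_mapE.
have [x xF ->] := gr_pieceP (u p).
by rewrite !gr_map_atE ?fmorph_fil // gf tau0.
Qed.

Lemma exact_at_grP (f : fmorph FA FB) (g : fmorph FB FC) :
  (forall x, g (f x) = 0) ->
  exact_at (gr_map f) (gr_map g) <-> gr_exact f g.
Proof.
move=> gf; split=> [E p y yF gyF|E u].
  have /E[u uE] : gr_map g (gr_in FB p y) = 0.
    rewrite gr_map_in //; apply: dirsumP => q; have [<-|pq] := eqVneq p q.
      by apply/eqP; rewrite gr_inE tau_eq0 //; apply: fmorph_fil.
    by rewrite gr_in_neq.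
  have [x xF xE] := gr_pieceP (u p); exists x => //.
  have := congr1 (fun v : gr FB => v p) uE.
  rewrite gr_mapE gr_inE xE gr_map_atE // => /eqP; rewrite eq_sym.
  by rewrite eq_tau ?fmorph_fil.
split=> [u0|[v <-]]; last exact: gr_map_comp0.
(* Choosing the preimage 0 wherever [u p] vanishes keeps the support finite. *)
have vEx p : {v : gr_piece FA p |
    gr_map_at f v = u p /\ (u p = 0 -> v = 0)}.
  apply: cid; have [->|up0] := eqVneq (u p) 0.
    by exists 0; split=> //; apply: gr_map_at0.
  have [y yF yE] := gr_pieceP (u p).
  have [|x xF yxF] := E p y yF.
    rewrite -tau_eq0 -?gr_map_atE -?yE //; last exact: fmorph_fil.
    by rewrite -gr_mapE u0.
  exists (tau FA p x); split; last by move=> /eqP; rewrite (negbTE up0).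
  by rewrite gr_map_atE // yE; apply/esym/eqP; rewrite eq_tau ?fmorph_fil.
pose v p := sval (vEx p).
have vfin : finite_set [set p | v p != 0]%classic.
  apply: sub_finite_set (dirsum_finite u) => p /=.
  by apply: contra_neq => /(svalP (vEx p)).2.
by exists (DirSum vfin : gr FA); apply: dirsumP => p; apply: (svalP (vEx p)).1.
Qed.

End GradedExactness.

Section FilteredExactness.
Variables (A B C : zmodType) (FA : int -> zmodClosed A).
Variables (FB : int -> zmodClosed B) (FC : int -> zmodClosed C).
Hypothesis FA_S : forall p x, x \in FA p -> x \in FA (p + 1).
Hypothesis FB_S : forall p x, x \in FB p -> x \in FB (p + 1).
Hypothesis FC_S : forall p x, x \in FC p -> x \in FC (p + 1).

Lemma fil_le (U : zmodType) (F : int -> zmodClosed U) :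
  (forall p x, x \in F p -> x \in F (p + 1)) ->
  forall (p q : int) x, (p <= q)%R -> x \in F p -> x \in F q.
Proof.
move=> FS p q x pq xF; have -> : q = p + `|q - p|%N by lia.
elim: `|q - p|%N => [|n IH]; first by rewrite addr0.
by have -> : p + n.+1 = (p + n) + 1; [lia|apply: FS].
Qed.

Definition strict_exact (f : A -> B) (g : B -> C) :=
  (forall p y, y \in FB p -> g y = 0 -> exists2 x, x \in FA p & f x = y) /\
  (forall p y, g y \in FC p -> exists2 y', y' \in FB p & g y' = g y).

Variables (f : fmorph FA FB) (g : fmorph FB FC).
Hypothesis gf : forall x, g (f x) = 0.

(** Strictness of [g] gives [y'] in degree [p - 1] with the same image as [y]. The cycle [y - y'] is
    then [f x] with [x] in degree [p], and [y - f x] is [y']. *)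
Lemma strict_exact_gr : strict_exact f g -> gr_exact FA FB FC f g.
Proof.
move=> [E S] p y yF /S[y' y'F gy'].
have yy'F : y - y' \in FB p.
  by rewrite rpredB //; apply: (fil_le FB_S) y'F; lia.
have [|x xF xE] := E p (y - y') yy'F; first by rewrite fmorphB gy' subrr.
by exists x => //; rewrite xE opprB addrC subrK.
Qed.

(** Both halves are successive approximations: subtracting a boundary lowers the degree of [y] by
    one and leaves [g y] unchanged. *)
Lemma gr_exact_strict :
  (exists p0 : int, forall (p : int) x, (p < p0)%R -> x \in FB p -> x = 0) ->
  (forall x, exists p, x \in FB p) ->
  gr_exact FA FB FC f g -> strict_exact f g.
Proof.
move=> [p0 FB0] FB_U E; split=> [p y yF gy|p y gyF].
  (* The process stops below [p0], where the filtration is zero; this bounds the number of steps. *)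
  have : (p < p0 + `|(p - p0 + 1)%R|%N)%R by lia.
  move: `|(p - p0 + 1)%R|%N => n; elim: n p y yF gy => [|n IH] p y yF gy pn.
    exists 0; first exact: rpred0.
    by rewrite fmorph0 (FB0 _ _ _ yF) //; lia.
  have [|x xF yxF] := E p y yF; first by rewrite gy rpred0.
  have [||x' x'F x'E] := IH _ _ yxF; first by rewrite fmorphB gf gy subrr.
    by lia.
  exists (x + x'); last by rewrite fmorphD x'E addrC subrK.
  by rewrite rpredD //; apply: (fil_le FA_S) x'F; lia.
(* Exhaustiveness gives a starting degree [q], which is lowered until it is at most [p]. *)
have [q yF] := FB_U y.
have : (q <= p + `|q - p|%N)%R by lia.
move: `|q - p|%N => n; elim: n q y yF gyF => [|n IH] q y yF gyF qp.
  by exists y => //; apply: (fil_le FB_S) yF; lia.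
case: (boolP (q <= p)%R) => [qlep|pq].
  by exists y => //; apply: (fil_le FB_S) yF; lia.
have [|x xF yxF] := E q y yF; first by apply: (fil_le FC_S) gyF; lia.
have gE : g (y - f x) = g y by rewrite fmorphB gf subr0.
by have [||y' y'F y'E] := IH _ _ yxF;
  rewrite ?gE //; [lia|exists y'; rewrite -?gE].
Qed.

End FilteredExactness.

(** * Graded duals *)

Lemma fin_int_bound r (d : 'I_r -> int) :
  exists b : int, forall k, - b <= d k /\ d k <= b.
Proof.
exists (\max_k `|d k|%N)%N => k.
by have := @leq_bigmax _ (fun k => `|d k|%N) k; lia.
Qed.

Lemma dual_sum (R : pzRingType) (X : lmodType R) (f : dual X) r
    (c : 'I_r -> R) (m : 'I_r -> X) :
  f (\sum_k c k *: m k) = \sum_k c k * f (m k).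
Proof. by rewrite linear_sum; apply: eq_bigr => k _; rewrite linearZ. Qed.

Section GradedPairingComponents.
Variables (A B C : zmodType) (FA : int -> zmodClosed A).
Variables (FB : int -> zmodClosed B) (FC : int -> zmodClosed C).
Variable f : fpairing FA FB FC.

Lemma gr_pair_comp p q x y (b : gr FB) : x \in FA p -> y \in FB q ->
  b q = tau FB q y ->
  gr_pair f (gr_in FA p x) b (p + q) = tau FC (p + q) (f x y).
Proof.
move=> xF yF bE.
(* The type of [b r] depends on [r], so the hypothesis at [q] is moved to the index [p + q - p]
   occurring in the product. *)
have b_at r : r = q -> y \in FB r /\ b r = tau FB r y by move=> ->.
have [|yF' bE'] := b_at (p + q - p); first by rewrite addrC addKr.
rewrite [LHS](@gr_pair_funE _ _ _ _ _ _ _ [:: p]) //; last first.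
  move=> r; rewrite inE; apply: contraNT => rp.
  by rewrite gr_in_neq // eq_sym.
by rewrite big_seq1 gr_inE bE' gr_pair_atE.
Qed.

End GradedPairingComponents.

Section FilteredRingModules.
Variable L : filtRing.

Lemma rfil_le p q (a : L) : p <= q -> a \in rfil L p -> a \in rfil L q.
Proof. exact: (fil_le (@rfilS L)). Qed.

Lemma mfil_le (X : prefiltMod L) p q (x : X) :
  p <= q -> x \in mfil X p -> x \in mfil X q.
Proof. exact: (fil_le (@mfilS L X)). Qed.

Lemma good_filtration_gens (X : prefiltMod L) :
  is_filtration X -> good_filtration X ->
  exists (r : nat) (d : 'I_r -> int) (m : 'I_r -> X),
  [/\ forall k, m k \in mfil X (d k),
      forall p x, x \in mfil X p -> exists2 c : 'I_r -> L,
        forall k, c k \in rfil L (p - d k) & x = \sum_k c k *: m k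
    & forall x, exists c : 'I_r -> L, x = \sum_k c k *: m k].
Proof.
move=> [_ X_U] [r [d [m X_good]]]; exists r, d, m; split.
- move=> k; apply/X_good; exists (fun j => (j == k)%:R) => [j|].
    have [->|jk] := eqVneq j k; last exact: rpred0.
    by rewrite subrr; apply: rfil1.
  rewrite (bigD1 k) //= eqxx scale1r big1 ?addr0 // => j jk.
  by rewrite (negbTE jk) scale0r.
- by move=> p x /X_good.
by move=> x; have [p /X_good[c _ ->]] := X_U x; exists c.
Qed.

Lemma mem_fdualP (X : prefiltMod L) p (f : dual X) :
  (f \in mfil (fdual X) p) <->
  (forall q x, x \in mfil X q -> f x \in rfil L (p + q)).
Proof. by split=> [/asboolP|fF]; [|apply/asboolP]. Qed.

(** A functional is determined by its values on the finitely many generators. In very negative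
    degree these values lie in negative parts of the ring, hence vanish; conversely, the degrees of
    the values bound the degree of the functional. *)
Lemma fdual_is_filtration (X : prefiltMod L) :
  is_filtration X -> good_filtration X -> is_filtration (fdual X).
Proof.
move=> X_fil X_good.
have [r [d [m [m_fil X_gen X_U]]]] := good_filtration_gens X_fil X_good.
split.
  have [b bP] := fin_int_bound d; exists (- b) => p f pb /mem_fdualP fF.
  apply: homP => x; have [c ->] := X_U x; rewrite dual_sum big1 // => k _.
  rewrite (rfil_neg _ (fF _ _ (m_fil k))) ?mulr0 //.
  by have := bP k; lia.
suff : forall f : dual X, exists p, f \in mfil (fdual X) p by [].
move=> f; have /choice[n nP] : forall k, exists p, f (m k) \in rfil L p.
  by move=> k; apply: rfilU.
have [b bP] := fin_int_bound (fun k => n k - d k).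
exists b; apply/mem_fdualP => q x /X_gen[c cF ->].
rewrite dual_sum rpred_sum // => k _.
by apply: rfil_le (rfilM (cF k) (nP k)); have := bP k; lia.
Qed.

End FilteredRingModules.

Section GradedLinear.
Variables (L : filtRing) (X Y : prefiltMod L) (f : {linear X -> Y}).
Hypothesis f_fil : filtered f.

Lemma lin_zmod_morphism : zmod_morphism f.
Proof. exact: raddfB. Qed.

Definition lin_fmorph : fmorph (mfil X) (mfil Y) :=
  FMorph lin_zmod_morphism f_fil.

Definition gr_lin_fun (x : grM X) : grM Y := gr_map lin_fmorph x.

Lemma gr_lin_linear : linear gr_lin_fun.
Proof.
move=> a x y; rewrite /gr_lin_fun [LHS]gr_mapD; congr (_ + _).
suff: gr_map lin_fmorph (gr_pair (mscale_pairing X) a x) =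
  gr_pair (mscale_pairing Y) a (gr_map lin_fmorph x) by [].
elim/gr_ind: x {y} => [|x x' IH IH'|q x xF].
- by rewrite !(gr_map0, gr_pair0r).
- by rewrite !(gr_mapD, gr_pairDr) IH IH'.
elim/gr_ind: a => [|a a' IH IH'|p a aF].
- by rewrite !gr_pair0l gr_map0.
- by rewrite !(gr_mapD, gr_pairDl) IH IH'.
rewrite gr_pair_in // !gr_map_in //; last exact: mfilZ.
by rewrite gr_pair_in //= ?linearZ //; apply: f_fil.
Qed.

HB.instance Definition _ := GRing.isLinear.Build (grR L) (grM X) (grM Y) *:%R
  gr_lin_fun gr_lin_linear.

Definition gr_lin : {linear grM X -> grM Y} := gr_lin_fun.

Lemma dual_map_zmod_morphism : zmod_morphism (dual_map f).
Proof. by move=> u v; apply: homP. Qed.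

Lemma dual_map_filtered :
  @filtered (fopp L) (fopp L) (fdual Y) (fdual X) (dual_map f).
Proof.
move=> p u /mem_fdualP uF; apply/mem_fdualP => q x xF.
exact/uF/f_fil.
Qed.

Definition dual_fmorph : fmorph (mfil (fdual Y)) (mfil (fdual X)) :=
  FMorph dual_map_zmod_morphism dual_map_filtered.

(** Naturality of [phi]; on homogeneous elements both sides are the class of [u (f x)]. *)
Lemma phi_gr_map (u : grM (fdual Y)) (x : grM X) :
  phi (gr_map dual_fmorph u : grM (fdual X)) x = phi u (gr_lin x).
Proof.
rewrite -[LHS]/(gr_pair (eval_pairing X) x (gr_map dual_fmorph u)).
rewrite -[RHS]/(gr_pair (eval_pairing Y) (gr_map lin_fmorph x) u).
elim/gr_ind: x => [|x x' IH IH'|q x xF].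
- by rewrite gr_map0 !gr_pair0l.
- by rewrite !(gr_mapD, gr_pairDl) IH IH'.
elim/gr_ind: u => [|u u' IH IH'|p u uF].
- by rewrite gr_map0 !gr_pair0r.
- by rewrite !(gr_mapD, gr_pairDr) IH IH'.
rewrite !gr_map_in // !gr_pair_in //; first exact: f_fil.
exact: dual_map_filtered.
Qed.

End GradedLinear.

Section PhiInjective.
Variables (L : filtRing) (X : prefiltMod L).

Lemma phi_comp p q (u : grM (fdual X)) (f : dual X) (x : X) :
  f \in mfil (fdual X) p -> u p = tau (mfil (fdual X)) p f ->
  x \in mfil X q ->
  (phi u (gr_in (mfil X) q x) : gr (rfil L)) (q + p)
    = tau (rfil L) (q + p) (f x).
Proof. by move=> fF uE xF; apply: (gr_pair_comp (eval_pairing X)). Qed.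

Lemma phi0 : phi (0 : grM (fdual X)) = 0.
Proof. exact: zmod_morphism0 (@phi_zmod_morphism L X). Qed.

Lemma phiD (u v : grM (fdual X)) : phi (u + v) = phi u + phi v.
Proof. exact: zmod_morphismD (@phi_zmod_morphism L X) u v. Qed.

(** If [phi] kills [u], a representative of [u p] sends each [mfil X q] into degree [p + q - 1], so
    it has degree [p - 1] and its class is zero. *)
Lemma phi_inj : injective (@phi L X).
Proof.
suff phi_eq0 (u : grM (fdual X)) : phi u = 0 -> u = 0.
  move=> u v uv; apply/eqP; rewrite -subr_eq0; apply/eqP/phi_eq0.
  by rewrite phi_zmod_morphism uv subrr.
move=> u0; suff: u = 0 :> gr (mfil (fdual X)) by [].
apply: dirsumP => p.
have [f fF fE] := gr_pieceP (u p); rewrite fE; apply/eqP; rewrite tau_eq0 //.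
apply/mem_fdualP => q x xF; move/mem_fdualP: (fF) => /(_ q x xF) fxF.
have := phi_comp fF fE xF; rewrite u0 addrC => /esym/eqP.
by rewrite tau_eq0 // addrAC.
Qed.

End PhiInjective.

Section PhiGradedMap.
Variables (L : filtRing) (X Y : prefiltMod L) (f : {linear X -> Y}).
Hypothesis f_fil : filtered f.

(** Naturality and injectivity of [phi] allow equations in [gr] of a dual to be checked in the dual
    of [gr]. *)
Lemma phi_gr_map_inj (u : grM (fdual X)) (v : grM (fdual Y)) :
  (forall x, phi u x = phi v (gr_lin f_fil x)) ->
  gr_map (dual_fmorph f_fil) v = u.
Proof.
move=> uv; apply: (@phi_inj L X); apply: homP => x.
by rewrite uv; apply: phi_gr_map.
Qed.

Lemma phi_gr_map_eq0 (v : grM (fdual Y)) :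
  (forall x, phi v (gr_lin f_fil x) = 0) -> gr_map (dual_fmorph f_fil) v = 0.
Proof. by move=> v0; apply: phi_gr_map_inj => x; rewrite v0 phi0. Qed.

End PhiGradedMap.

Lemma dual_basis_projective (R : pzRingType) (X : lmodType R) r
    (e : 'I_r -> X) (ep : 'I_r -> dual X) :
  (forall x, x = \sum_k (ep k x : R) *: e k) -> projective X.
Proof.
move=> basis A B g f g_surj.
have /choice[a aE] : forall k, exists x, g x = f (e k).
  by move=> k; apply: g_surj.
pose h x := \sum_k (ep k x : R) *: a k.
have hL : linear h.
  move=> c x y; rewrite /h scaler_sumr -big_split; apply: eq_bigr => k _.
  by rewrite /= linearP scalerDl scalerA.
exists (linear_of hL) => x; rewrite {2}(basis x) /= /h !linear_sum.
apply: eq_bigr => k _.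
by rewrite !linearZ /= aE.
Qed.

(** * Dual bases of filtered free modules *)

Section FilteredDualBasis.
Variables (L : filtRing) (X : prefiltMod L).

(** Freeness is exploited through the coordinate functionals: since [ep k] has degree opposite to
    that of [e k], the classes of both form a dual basis of [gr X]. *)
Definition filtered_dual_basis r (d : 'I_r -> int) (e : 'I_r -> X)
    (ep : 'I_r -> dual X) :=
  [/\ forall k, e k \in mfil X (d k),
      forall k, ep k \in mfil (fdual X) (- d k)
    & forall x, x = \sum_k (ep k x : L) *: e k].

Lemma filtered_free_dual_basis : filtered_free X ->
  exists r d e ep, @filtered_dual_basis r d e ep.
Proof.
move=> [r [e [d [freeX filX]]]].
have /choice[co coE] : forall x, exists c : 'I_r -> L, x = \sum_k c k *: e k.
  by move=> x; have [c []] := freeX x; exists c.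
have coU x c : x = \sum_k c k *: e k -> co x = c.
  move=> xE; have [c' [_ c'U]] := freeX x.
  by rewrite -(c'U _ xE) (c'U _ (coE x)).
have coL k : linear (fun x => co x k : L^o).
  move=> a x y; rewrite (coU _ (fun j => a * co x j + co y j)) //.
  rewrite {1}(coE x) {1}(coE y) scaler_sumr -big_split; apply: eq_bigr => j _.
  by rewrite scalerDl scalerA.
pose ep k : dual X := to_hom (linear_of (coL k)).
have epE k x : ep k x = co x k by [].
exists r, d, e, ep; split=> // k; last first.
  apply/mem_fdualP => q x /filX[c cF /coU]; rewrite epE => ->.
  by rewrite addrC.
have eE : e k = \sum_j (j == k)%:R *: e j.
  rewrite (bigD1 k) //= eqxx scale1r big1 ?addr0 // => j jk.
  by rewrite (negbTE jk) scale0r.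
apply/filX; exists (fun j => (j == k)%:R) => // j.
have [->|jk] := eqVneq j k; last exact: rpred0.
by rewrite subrr; apply: rfil1.
Qed.

Variables (r : nat) (d : 'I_r -> int) (e : 'I_r -> X) (ep : 'I_r -> dual X).
Hypothesis basis : filtered_dual_basis d e ep.

Lemma dual_basis_good : good_filtration X.
Proof.
case: basis => eF epF eE; exists r, d, e => p x; split=> [xF|[c cF ->]].
  exists (fun k => ep k x) => // k; rewrite addrC.
  by have /mem_fdualP := epF k; apply.
rewrite rpred_sum // => k _.
by have := mfilZ (cF k) (eF k); rewrite subrK.
Qed.

Lemma dual_basis_filtration : is_filtration X.
Proof.
case: basis => eF epF eE; have [b bP] := fin_int_bound d; split.
  exists (- b) => p x pb xF; rewrite (eE x) big1 // => k _.
  have /mem_fdualP/(_ _ _ xF) := epF k.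
  have epk0 : - d k + p < 0 by have := bP k; lia.
  by move/(rfil_neg epk0) => ->; rewrite scale0r.
move=> x; have /choice[n nP] : forall k, exists p, (ep k x : L) \in rfil L p.
  by move=> k; apply: rfilU.
have [c cP] := fin_int_bound (fun k => n k + d k).
exists c; rewrite (eE x) rpred_sum // => k _.
by apply: mfil_le (mfilZ (nP k) (eF k)); have := cP k; lia.
Qed.

(** For [y] of degree [p], every term of the expansion of [y] in the basis has degree [p], so
    classes can be taken term by term. *)
Lemma gr_dual_basis (x : grM X) :
  x = \sum_k (phi (gr_in (mfil (fdual X)) (- d k) (ep k)) x : grR L)
        *: (gr_in (mfil X) (d k) (e k) : grM X).
Proof.
case: basis => eF epF eE.
pose h (y : grM X) : grM X :=
  \sum_k (phi (gr_in (mfil (fdual X)) (- d k) (ep k)) y : grR L)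
    *: (gr_in (mfil X) (d k) (e k) : grM X).
suff: x = h x by [].
have hD y z : h (y + z) = h y + h z.
  rewrite /h -big_split; apply: eq_bigr => k _ /=.
  by rewrite linearD scalerDl.
elim/gr_ind: x => [|y z IH IH'|p y yF].
- by apply: (addIr (h 0)); rewrite -hD !add0r.
- by rewrite [LHS](_ : _ = (y : grM X) + z) // {1}IH {1}IH' -hD.
have c_fil k : (ep k y : L) \in rfil L (p - d k).
  by have /mem_fdualP/(_ _ _ yF) := epF k; rewrite addrC.
have zF k : (ep k y : L) *: e k \in mfil X p.
  by have := mfilZ (c_fil k) (eF k); rewrite subrK.
rewrite {1}(eE y) gr_in_sum // /h; apply: eq_bigr => k _.
rewrite [phi _ _]phi_tau //.
rewrite -[RHS]/(gr_pair (mscale_pairing X)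
  (gr_in (rfil L) (- d k + p) (ep k y)) (gr_in (mfil X) (d k) (e k))).
rewrite gr_pair_in //; last by rewrite addrC; apply: c_fil.
by rewrite addrAC addNr add0r.
Qed.

End FilteredDualBasis.

Lemma inj_onto_bij (A B : Type) (f : A -> B) :
  injective f -> onto f -> bijective f.
Proof.
move=> f_inj /choice[g gK]; exists g => // x.
by apply: f_inj; rewrite gK.
Qed.

Section DualBasisPhi.
Variables (L : filtRing) (X : prefiltMod L).
Variables (r : nat) (d : 'I_r -> int) (e : 'I_r -> X) (ep : 'I_r -> dual X).
Hypothesis basis : filtered_dual_basis d e ep.

Lemma dual_basis_phi_onto : onto (@phi L X).
Proof.
move=> u.
(* The expected preimage of [u]: the combination of the classes of the [ep k] whose coefficients are
   the values of [u] on the basis. *)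
pose c k : grR (fopp L) := u (gr_in (mfil X) (d k) (e k)).
pose epk k : grM (fdual X) := gr_in (mfil (fdual X)) (- d k) (ep k).
have phi_sum (s : seq 'I_r) : phi (\sum_(k <- s) c k *: epk k)
    = \sum_(k <- s) grR_fopp (c k) *: phi (epk k).
  elim: s => [|k s IH].
    by rewrite !big_nil phi0.
  by rewrite !big_cons -IH -phiZ phiD.
exists (\sum_k c k *: epk k); rewrite phi_sum; apply: homP => x.
rewrite {2}(gr_dual_basis basis x) dual_sum.
have sumE (s : seq 'I_r) :
    hom_fun (\sum_(k <- s) grR_fopp (c k) *: phi (epk k)) x =
    \sum_(k <- s) (phi (epk k) x : grR L) * u (gr_in (mfil X) (d k) (e k)).
  by elim: s => [|k s IH]; rewrite ?big_nil // !big_cons homDE IH.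
exact: sumE.
Qed.

Lemma dual_basis_phi_bij : bijective (@phi L X).
Proof. exact: inj_onto_bij (@phi_inj L X) dual_basis_phi_onto. Qed.

Lemma gr_projective : projective (grM X).
Proof.
apply: (@dual_basis_projective (grR L) (grM X) r
  (fun k => gr_in (mfil X) (d k) (e k))
  (fun k => phi (gr_in (mfil (fdual X)) (- d k) (ep k)))) => x.
exact: gr_dual_basis.
Qed.

End DualBasisPhi.

Lemma factor_onto (R : pzRingType) (A B C : lmodType R) (h : {linear A -> B})
    (f : {linear A -> C}) :
  onto h -> (forall x, h x = 0 -> f x = 0) ->
  exists g : {linear B -> C}, forall x, g (h x) = f x.
Proof.
move=> /choice[s sK] hf.
have fE x y : h x = h y -> f x = f y.
  move=> xy; apply/eqP; rewrite -subr_eq0 -linearB; apply/eqP/hf.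
  by rewrite linearB xy subrr.
have gL : linear (fun y => f (s y)).
  by move=> a y z; rewrite -linearP; apply: fE; rewrite linearP !sK.
by exists (linear_of gL) => x; apply: fE; rewrite sK.
Qed.

Lemma strict_exactI (L L' L'' : filtRing) (X : prefiltMod L)
    (Y : prefiltMod L') (Z : prefiltMod L'') (f : X -> Y) (g : Y -> Z) :
  exact_at f g -> strict f -> strict g ->
  strict_exact (mfil X) (mfil Y) (mfil Z) f g.
Proof.
move=> ex fS gS; split=> [p y yF /ex yE|p y gyF].
  by have [_ H] := fS p y; apply: H.
by have [_ []] := gS p (g y); [split=> //; exists y|move=> y' ? ?; exists y'].
Qed.

Lemma gr_map_onto (V W : zmodType) (F : int -> zmodClosed V)
    (G : int -> zmodClosed W) (f : fmorph F G) :
  (forall p y, y \in G p -> exists2 x, x \in F p & f x = y) -> onto (gr_map f).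
Proof.
move=> f_onto; elim/gr_ind => [|u v [x <-] [y <-]|p y /f_onto[x xF <-]].
- by exists 0; apply: gr_map0.
- by exists (x + y); apply: gr_mapD.
by exists (gr_in F p x); apply: gr_map_in.
Qed.

(** * Filtered free resolutions *)

Section Resolution.
Variables (L : filtRing) (N : prefiltMod L) (F : ff_resolution N).

Local Notation d_fil i := (proj1 (ff_d_strict F i)).
Local Notation d_strict i := (proj2 (ff_d_strict F i)).
Local Notation aug_fil := (proj1 (ff_aug_strict F)).
Local Notation aug_strict := (proj2 (ff_aug_strict F)).
Local Notation d_fstar i := (dual_fmorph (d_fil i)).

Lemma ff_dd i x : ff_d F i (ff_d F i.+1 x) = 0.
Proof. by apply/(ff_exact (f := F)); exists x. Qed.

Lemma ff_aug_d x : ff_aug F (ff_d F 0 x) = 0.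
Proof. by apply/(ff_exact0 (f := F)); exists x. Qed.

Lemma ff_projective i : projective (F i).
Proof.
have [r [d [e [ep [_ _ eE]]]]] := filtered_free_dual_basis (ff_free F i).
exact: dual_basis_projective eE.
Qed.

Definition ff_proj_resolution : proj_resolution N :=
  @ProjResolution L N (fun i => F i) (ff_d F) (ff_aug F) ff_projective
    (@ff_surj _ _ F) (@ff_exact0 _ _ F) (@ff_exact _ _ F).

Lemma gr_ff_projective i : projective (grM (F i)).
Proof.
have [r [d [e [ep basis]]]] := filtered_free_dual_basis (ff_free F i).
exact: gr_projective basis.
Qed.

Lemma gr_ff_onto : onto (gr_lin aug_fil).
Proof.
apply: gr_map_onto => p y yF.
have [_] := aug_strict p y; apply; split=> //; exact: (ff_surj F).
Qed.

Lemma gr_ff_exact0 : exact_at (gr_lin (d_fil 0)) (gr_lin aug_fil).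
Proof.
apply/exact_at_grP; first exact: ff_aug_d.
apply: strict_exact_gr; [exact: mfilS|].
apply: strict_exactI; [exact: ff_exact0|exact: (d_strict _)|exact: aug_strict].
Qed.

Lemma gr_ff_exact i : exact_at (gr_lin (d_fil i.+1)) (gr_lin (d_fil i)).
Proof.
apply/exact_at_grP; first exact: ff_dd.
apply: strict_exact_gr; [exact: mfilS|].
apply: strict_exactI; [exact: ff_exact|exact: (d_strict _)..].
Qed.

Definition gr_proj_resolution : proj_resolution (grM N) :=
  @ProjResolution (grR L) (grM N) (fun i => grM (F i))
    (fun i => gr_lin (d_fil i)) (gr_lin aug_fil) gr_ff_projective gr_ff_onto
    gr_ff_exact0 gr_ff_exact.

Lemma dual_dd i (u : dual (F i)) : d_fstar i.+1 (d_fstar i u) = 0.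
Proof.
apply: homP => x; rewrite -[LHS]/(u (ff_d F i (ff_d F i.+1 x))) ff_dd.
exact: linear0.
Qed.

(** By naturality the bijections [phi] on the terms of [F] identify the dual of [gr F] with [gr] of
    the dual complex. *)
Lemma gr_dual_exactP i :
  dual_exact (grR L)^o gr_proj_resolution i <->
  gr_exact (mfil (fdual (F i))) (mfil (fdual (F i.+1)))
    (mfil (fdual (F i.+2))) (d_fstar i) (d_fstar i.+1).
Proof.
have phi_bij j : bijective (@phi L (F j)).
  have [r [d [e [ep basis]]]] := filtered_free_dual_basis (ff_free F j).
  exact: dual_basis_phi_bij basis.
rewrite -exact_at_grP; last exact: dual_dd.
split=> E.
  move=> u; split=> [u0|[v <-]]; last by apply: gr_map_comp0; apply: dual_dd.
  have [|v vE] := E (phi u).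
    by move=> x; rewrite -[LHS](phi_gr_map (d_fil i.+1)) u0 phi0.
  have [g _ gK] := phi_bij i; exists (g v).
  by apply: phi_gr_map_inj => x; rewrite gK vE.
move=> u u0; have [g _ gK] := phi_bij i.+1.
have [|v vE] := (E (g u)).1.
  by apply: phi_gr_map_eq0 => x; rewrite gK; apply: u0.
by exists (phi v) => x; rewrite -[u]gK -vE; apply: phi_gr_map.
Qed.

Lemma ff_dual_filtration i : is_filtration (fdual (F i)).
Proof.
have [r [d [e [ep basis]]]] := filtered_free_dual_basis (ff_free F i).
exact: fdual_is_filtration (dual_basis_filtration basis)
  (dual_basis_good basis).
Qed.

(** Exactness of the graded dual complex at the term of index [i.+1] yields filtered exactness
    there, which contains both the vanishing of [Ext^(i+1)] and the strictness of the incoming map.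
    The converse combines the strictness of the incoming and outgoing maps. *)
Lemma gr_Ext_eq0P :
  (forall k, (0 < k)%N -> Ext_eq0 k (grM N) (grR L)^o) <->
  (forall k, (0 < k)%N -> Ext_eq0 k N L^o) /\
  (forall i, @strict (fopp L) (fopp L) (fdual (F i)) (fdual (F i.+1))
     (dual_map (ff_d F i))).
Proof.
rewrite (Ext_eq0P _ gr_proj_resolution) (Ext_eq0P _ ff_proj_resolution).
split=> [E|[E S] i].
  have SE i : strict_exact (mfil (fdual (F i))) (mfil (fdual (F i.+1)))
      (mfil (fdual (F i.+2))) (d_fstar i) (d_fstar i.+1).
    have [F0 FU] := ff_dual_filtration i.+1.
    by apply: gr_exact_strict;
      [exact: mfilS..|exact: dual_dd| | |exact/gr_dual_exactP].
  split=> [i u u0|i p u].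
    have [p uF] := (ff_dual_filtration i.+1).2 u.
    have [|v _ vE] := (SE i).1 p u uF; first exact: homP.
    by exists v => x; rewrite -vE.
  split=> [[v vF <-]|[[v vE] uF]].
    (* For the other inclusion, an element of the image is a cycle, hence a boundary from the same
       filtration degree. *)
    by split; [exists v|exact: (dual_map_filtered (d_fil i))].
  have [|v' v'F v'E] := (SE i).1 p u uF; last by exists v'.
  by rewrite -vE; apply: dual_dd.
apply/gr_dual_exactP/strict_exact_gr; first exact: mfilS.
apply: strict_exactI => // u; split=> [u0|[v <-]]; last exact: dual_dd.
have [|v vE] := E i u.
  by move=> x; rewrite -[LHS]/((d_fstar i.+1 u : dual (F i.+2)) x) u0.
by exists v; apply: homP.
Qed.

(** For surjectivity, [u] is pulled back to [gr (F 0)], where [phi] is onto. The resulting [w] is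
    killed by [gr] of the dual of [ff_d F 0], and exactness at the dual of [F 0] makes it come from
    the dual of [N]. *)
Lemma phi_bijective :
  @strict (fopp L) (fopp L) (fdual (F 0%N)) (fdual (F 1%N))
    (dual_map (ff_d F 0)) ->
  bijective (@phi L N).
Proof.
move=> d0S; apply: inj_onto_bij; first exact: phi_inj.
move=> u.
have [r [d [e [ep basis]]]] := filtered_free_dual_basis (ff_free F 0).
have [w wE] := dual_basis_phi_onto basis (dual_map (gr_lin aug_fil) u).
pose aug_star := dual_fmorph aug_fil.
have ex : gr_exact (mfil (fdual N)) (mfil (fdual (F 0%N)))
    (mfil (fdual (F 1%N))) aug_star (d_fstar 0).
  apply: strict_exact_gr; first exact: mfilS.
  split=> [p|p f fF]; last first.
    have [_ []] := d0S p (d_fstar 0 f); last by move=> f' ? ?; exists f'.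
    by split=> //; exists f.
  suff: forall f : dual (F 0%N), f \in mfil (fdual (F 0%N)) p ->
      d_fstar 0 f = 0 ->
      exists2 g, g \in mfil (fdual N) p & aug_star g = f by [].
  (* A functional vanishing on the boundaries factors through the augmentation. *)
  move=> f fF f0; have [|g gE] := factor_onto (f := hom_fun f) (@ff_surj _ _ F).
    move=> x /(ff_exact0 (f := F))[y <-].
    by rewrite -[LHS]/((d_fstar 0 f : dual (F 1%N)) y) f0.
  exists (to_hom g); last by apply: homP => x; apply: gE.
  apply/mem_fdualP => q y yF.
  (* The factor keeps degree [p] because strictness lifts [y] without raising its degree. *)
  have [_ [|x xF <-]] := aug_strict q y; first by split=> //; apply: ff_surj.
  by rewrite -[X in X \in _]/(g (ff_aug F x)) gE; move/mem_fdualP: fF; apply.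
have aug_dd (f : dual N) : d_fstar 0 (aug_star f) = 0.
  apply: homP => x; rewrite -[LHS]/(f (ff_aug F (ff_d F 0 x))) ff_aug_d.
  exact: linear0.
have [|v vE] := ((exact_at_grP aug_dd).2 ex w).1.
  apply: phi_gr_map_eq0 => x.
  rewrite wE -[LHS]/(u (gr_lin aug_fil (gr_lin (d_fil 0) x))).
  have -> : gr_lin aug_fil (gr_lin (d_fil 0) x) = 0.
    by apply/gr_ff_exact0; exists x.
  exact: linear0.
exists v; apply: homP => y; have [x <-] := gr_ff_onto y.
by rewrite -(phi_gr_map aug_fil) vE wE.
Qed.

End Resolution.

(** * Noetherian rings and good filtrations *)

Section GradedPairingFlip.
Variables (A B C : zmodType) (FA : int -> zmodClosed A).
Variables (FB : int -> zmodClosed B) (FC : int -> zmodClosed C).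
Variable f : fpairing FA FB FC.

Lemma fpair_flip_fil p q y x : y \in FB p -> x \in FA q -> f x y \in FC (p + q).
Proof. by move=> yF xF; rewrite addrC; apply: fpair_fil. Qed.

Definition fpair_flip : fpairing FB FA FC :=
  FPairing (fpairBr f) (fpairBl f) fpair_flip_fil.

Lemma gr_pairC a b : gr_pair f a b = gr_pair fpair_flip b a.
Proof.
elim/gr_ind: a => [|a a' IH IH'|p x xF].
- by rewrite gr_pair0l gr_pair0r.
- by rewrite gr_pairDl gr_pairDr IH IH'.
elim/gr_ind: b => [|b b' IH IH'|q y yF].
- by rewrite gr_pair0l gr_pair0r.
- by rewrite gr_pairDl gr_pairDr IH IH'.
by rewrite !gr_pair_in // addrC.
Qed.

Lemma gr_pair_compr p q x y (a : gr FA) : x \in FA p -> y \in FB q ->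
  a p = tau FA p x ->
  gr_pair f a (gr_in FB q y) (p + q) = tau FC (p + q) (f x y).
Proof.
move=> xF yF aE; rewrite gr_pairC addrC.
exact: (gr_pair_comp fpair_flip).
Qed.

End GradedPairingFlip.

(** Arbitrary finite index types let families of generators be joined by sums and products of
    types. *)
Definition finitely_generated (R : pzRingType) (X : lmodType R) :=
  exists (I : finType) (g : I -> X), forall x, exists c : I -> R,
    x = \sum_i c i *: g i.

(** The functionals embed [X] into a free module of rank [n]. By induction, preimages of generators
    of the image of the first functional, a left ideal, are joined to generators of its kernel,
    which the remaining functionals embed in rank one less. *)
Lemma noetherian_finitely_generated (R : pzRingType) : noetherian R ->
  forall n (X : lmodType R) (ep : 'I_n -> dual X),
  (forall x, (forall k, ep k x = 0) -> x = 0) -> finitely_generated X.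
Proof.
move=> R_noeth; elim=> [|n IH] X ep ep0.
  exists void, (fun i : void => match i with end) => x; exists (fun=> 0).
  by rewrite big1 => [|[]//]; apply: ep0 => -[].
pose f := ep ord0; pose J : {pred R^o} := fun a => `[< exists x, f x = a >].
have J_closed : submod_closed J.
  split=> [|a u v /asboolP[x xE] /asboolP[y yE]].
    by apply/asboolP; exists 0; apply: linear0.
  by apply/asboolP; exists (a *: x + y); rewrite -xE -yE; apply: linearP.
have [r [g gE]] := R_noeth J J_closed.
have /choice[y yE] : forall k, exists y, f y = g k.
  move=> k; have /asboolP// : g k \in J.
  apply/gE; exists (fun j => (j == k)%:R).
  rewrite (bigD1 k) //= eqxx mul1r big1 ?addr0 // => j jk.
  by rewrite (negbTE jk) mul0r.
pose ep' k : dual (kerMod f) := to_hom (ep (lift ord0 k) \o val).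
have [|I [h hE]] := IH _ ep'.
  move=> x x0; apply: val_inj; apply: ep0 => k.
  case: (unliftP ord0 k) => [j|] ->; first exact: (x0 j).
  by apply/eqP; exact: (valP x).
exists ('I_r + I)%type,
  (fun i => match i with inl k => y k | inr j => val (h j) end) => x.
have /gE[c cE] : (f x : R) \in J by apply/asboolP; exists x.
have xK : x - \sum_k c k *: y k \in ker_pred f.
  apply/eqP; rewrite linearB /= dual_sum cE.
  by under [X in _ - X]eq_bigr do rewrite yE; rewrite subrr.
have [c' c'E] := hE (Sub (x - \sum_k c k *: y k) xK : kerMod f).
exists (fun i => match i with inl k => c k | inr j => c' j end).
rewrite big_sumType /=; have := congr1 val c'E; rewrite SubK => xE.
apply/eqP; rewrite addrC -subr_eq xE raddf_sum; apply/eqP/eq_bigr => j _.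
exact: (linearZZ (val : kerMod f -> X)).
Qed.

Section GoodFiltrations.
Variables (L : filtRing) (Y : prefiltMod L).
Hypothesis Y_fil : is_filtration Y.

(** The remainders are expanded in turn, and the corrections end because the filtration is bounded
    below. *)
Lemma gr_generated_good (I : finType) (d : I -> int) (m : I -> Y) :
  (forall i, m i \in mfil Y (d i)) ->
  (forall p y, y \in mfil Y p -> exists2 c : I -> L,
     forall i, c i \in rfil L (p - d i)
     & y - \sum_i c i *: m i \in mfil Y (p - 1)) ->
  good_filtration Y.
Proof.
move=> mF mE; have [[p0 Y0] _] := Y_fil.
exists #|I|, (fun i => d (enum_val i)), (fun i => m (enum_val i)) => p y.
have sumE (c : I -> L) :
    \sum_i c i *: m i = \sum_(k < #|I|) c (enum_val k) *: m (enum_val k).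
  by rewrite (reindex _ (onW_bij _ (@enum_val_bij I))).
split=> [yF|[c cF ->]]; last first.
  rewrite rpred_sum // => k _.
  by have := mfilZ (cF k) (mF (enum_val k)); rewrite subrK.
suff [c cF ->] : exists2 c : I -> L, forall i, c i \in rfil L (p - d i)
    & y = \sum_i c i *: m i.
  by exists (fun k => c (enum_val k)).
have : p < p0 + `|(p - p0 + 1)%R|%N by lia.
move: `|(p - p0 + 1)%R|%N => n; elim: n p y yF => [|n IH] p y yF pn.
  exists (fun=> 0) => [i|]; first exact: rpred0.
  rewrite (Y0 p y) //; last by lia.
  by rewrite big1 // => i _; rewrite scale0r.
have [c cF /IH[|c' c'F yE]] := mE p y yF; first by lia.
exists (fun i => c i + c' i) => [i|].
  by rewrite rpredD //; apply: rfil_le (c'F i); lia.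
under eq_bigr do rewrite scalerDl.
by rewrite big_split -yE /= addrC subrK.
Qed.

(** Allowing every larger list [s'] lets one list of degrees serve several elements at once. *)
Lemma gr_sum_components (u : gr (mfil Y)) : exists s : seq int,
  forall s', uniq s' -> {subset s <= s'} ->
  u = \sum_(p <- s') gr_in (mfil Y) p (subquo_repr (u p)).
Proof.
have u_fin := dirsum_finite u.
have [s sE] : exists s : seq int, forall p, u p != 0 -> p \in s.
  have /finite_seqP[s sE] := u_fin; exists s => p up.
  by have : [set p | u p != 0]%classic p := up; rewrite sE.
exists s => s' s'_uniq ss'; apply: dirsumP => p; rewrite dirsum_sumE.
have uE q : tau (mfil Y) q (subquo_repr (u q)) = u q.
  by rewrite /tau subquo_reprK.
have [up0|up] := eqVneq (u p) 0.
  apply: (etrans up0); rewrite big1 // => q _; have [qp|qp] := eqVneq q p.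
    by rewrite qp gr_inE uE; apply: up0.
  by rewrite gr_in_neq.
rewrite (bigD1_seq p) ?ss' ?sE // gr_inE big1 => [|q qp].
  by rewrite Monoid.mulm1 uE.
by rewrite gr_in_neq.
Qed.

(** Representatives of the homogeneous components of the generators generate the filtration. *)
Lemma gr_finitely_generated_good :
  finitely_generated (grM Y) -> good_filtration Y.
Proof.
move=> [I [g gE]].
have [s s_uniq sE] : exists2 s : seq int, uniq s & forall i,
    g i = \sum_(p <- s) gr_in (mfil Y) p (subquo_repr (g i p)) :> gr (mfil Y).
  have /choice[s sE] := fun i => gr_sum_components (g i).
  exists (undup (flatten [seq s i | i <- enum I])); first exact: undup_uniq.
  move=> i; apply: sE (undup_uniq _) _ => p ps; rewrite mem_undup.
  by apply/flattenP; exists (s i) => //; apply: map_f; rewrite mem_enum.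
pose d (j : I * 'I_(size s)) := s`_j.2.
pose m (j : I * 'I_(size s)) : Y := subquo_repr (g j.1 (d j)).
have mF j : m j \in mfil Y (d j) by apply: subquo_reprP.
apply: (@gr_generated_good _ d m) => // p y yF.
have [a aE] := gE (gr_in (mfil Y) p y).
(* Only the component of degree [p - d j] of a coefficient contributes to the product in degree
   [p]. *)
pose c j : L := subquo_repr (a j.1 (p - d j) : gr_piece (rfil L) (p - d j)).
have cF j : c j \in rfil L (p - d j) by apply: subquo_reprP.
exists c => //.
have termF j : c j *: m j \in mfil Y p.
  by have := mfilZ (cF j) (mF j); rewrite subrK.
rewrite -eq_tau ?rpred_sum // -gr_inE [gr_in _ _ _]aE.
pose gm j : grM Y := gr_in (mfil Y) (d j) (m j).
have -> : \sum_i a i *: g i = \sum_j a j.1 *: gm j.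
  rewrite -(pair_bigA _ (fun i k => a i *: gm (i, k))) /=.
  apply: eq_bigr => i _; rewrite -scaler_sumr; congr (_ *: _).
  by rewrite [LHS]sE (big_nth 0) big_mkord.
rewrite dirsum_sumE.
have tau_sum (r : seq (I * 'I_(size s))) :
    tau (mfil Y) p (\sum_(j <- r) c j *: m j) =
    \sum_(j <- r) tau (mfil Y) p (c j *: m j).
  elim: r => [|j r IH]; first by rewrite !big_nil tau0.
  by rewrite !big_cons tauD ?rpred_sum // IH.
rewrite tau_sum; apply/eqP/eq_bigr => j _.
rewrite -[LHS]/(gr_pair (mscale_pairing Y) (a j.1) (gm j) p).
have := gr_pair_compr (mscale_pairing Y) (a := a j.1) (cF j) (mF j).
by rewrite subrK => ->; rewrite /tau ?subquo_reprK.
Qed.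

(** The functionals [ep k] induce jointly injective functionals on [grM Y],
    which thus embeds into a finite power of the noetherian ring [grR L]. *)
Lemma cogenerated_good (n : nat) (del : 'I_n -> int) (ep : 'I_n -> dual Y) :
  noetherian (grR L) ->
  (forall k, ep k \in mfil (fdual Y) (del k)) ->
  (forall p y, y \in mfil Y p ->
     (forall k, (ep k y : L) \in rfil L (p + del k - 1)) ->
     y \in mfil Y (p - 1)) ->
  good_filtration Y.
Proof.
move=> gr_noeth epF cogen; apply: gr_finitely_generated_good.
apply: (noetherian_finitely_generated gr_noeth
  (ep := fun k => phi (gr_in (mfil (fdual Y)) (del k) (ep k)))) => x x0.
suff: x = 0 :> gr (mfil Y) by [].
apply: dirsumP => p; have [y yF xE] := gr_pieceP (x p).
rewrite xE; apply/eqP; rewrite tau_eq0 //; apply: cogen => // k.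
rewrite -tau_eq0; last by rewrite addrC; have /mem_fdualP := epF k; apply.
rewrite -[tau _ _ _](gr_pair_compr (eval_pairing Y) yF (epF k) xE).
by rewrite [gr_pair _ _ _](x0 k).
Qed.

End GoodFiltrations.

(** * Filtered free covers and existence of resolutions *)

Section FilteredFree.
Variables (L : filtRing) (r : nat) (d : 'I_r -> int).

Definition shifted_fil (p : int) : {pred 'rV[L]_r} :=
  fun u => [forall k, u 0 k \in rfil L (p - d k)].

Lemma shifted_filP p (u : 'rV[L]_r) :
  reflect (forall k, u 0 k \in rfil L (p - d k)) (u \in shifted_fil p).
Proof. exact: forallP. Qed.

Lemma shifted_fil_zmod_closed p : zmod_closed (shifted_fil p).
Proof.
split=> [|u v /shifted_filP uF /shifted_filP vF]; apply/shifted_filP => k.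
  by rewrite mxE rpred0.
by rewrite !mxE rpredB.
Qed.
HB.instance Definition _ p :=
  GRing.isZmodClosed.Build 'rV[L]_r (shifted_fil p) (shifted_fil_zmod_closed p).

Lemma shifted_filS p (u : 'rV[L]_r) :
  u \in shifted_fil p -> u \in shifted_fil (p + 1).
Proof.
move=> /shifted_filP uF; apply/shifted_filP => k.
by rewrite addrAC; apply: rfilS.
Qed.

Lemma shifted_filZ p q (a : L) (u : 'rV[L]_r) :
  a \in rfil L p -> u \in shifted_fil q -> a *: u \in shifted_fil (p + q).
Proof.
move=> aF /shifted_filP uF; apply/shifted_filP => k.
by rewrite mxE -addrA; apply: rfilM.
Qed.

Definition shifted_free : prefiltMod L :=
  @PrefiltMod L 'rV[L]_r shifted_fil shifted_filS shifted_filZ.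

Lemma row_delta_sum (c : 'I_r -> L) :
  \sum_k c k *: delta_mx 0 k = \row_k c k.
Proof.
apply/rowP => j; rewrite summxE mxE (bigD1 j) //= !mxE !eqxx mulr1.
rewrite big1 ?addr0 // => k kj.
by rewrite !mxE eqxx eq_sym (negbTE kj) mulr0.
Qed.

Lemma shifted_free_free : filtered_free shifted_free.
Proof.
exists r, (fun k => delta_mx 0 k : 'rV[L]_r), d; split=> [u|p u].
  exists (fun k => (u : 'rV[L]_r) 0 k); split=> [|c ->].
    by rewrite row_delta_sum; apply/rowP => k; rewrite mxE.
  by apply/funext => k; rewrite row_delta_sum mxE.
split=> [/shifted_filP uF|[c cF ->]].
  exists (fun k => (u : 'rV[L]_r) 0 k) => //.
  by rewrite row_delta_sum; apply/rowP => k; rewrite mxE.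
by rewrite row_delta_sum; apply/shifted_filP => k; rewrite mxE.
Qed.

Variables (X : prefiltMod L) (m : 'I_r -> X).

Definition shifted_ext (u : shifted_free) : X :=
  \sum_k (u : 'rV[L]_r) 0 k *: m k.

Lemma shifted_ext_linear : linear shifted_ext.
Proof.
move=> a u v; rewrite /shifted_ext scaler_sumr -big_split.
by apply: eq_bigr => k _; rewrite !mxE scalerDl scalerA.
Qed.
HB.instance Definition _ :=
  GRing.isLinear.Build L shifted_free X *:%R shifted_ext shifted_ext_linear.

End FilteredFree.

Record filtered_cover (L : filtRing) (X : prefiltMod L) := FilteredCover {
  fc_mod :> prefiltMod L;
  fc_map : {linear fc_mod -> X};
  fc_free : filtered_free fc_mod;
  fc_filtered : filtered fc_map;
  fc_strict : strict fc_map;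
  fc_onto : onto fc_map }.

(** The basis vectors, placed in the degrees of the generators, are sent to these generators;
    goodness of the filtration is strictness. The cover is extracted as data so that syzygies can be
    defined by recursion. *)
Lemma good_filtered_cover (L : filtRing) (X : prefiltMod L) :
  is_filtration X -> good_filtration X -> filtered_cover X.
Proof.
move=> [_ X_U] /cid[r /cid[d /cid[m mE]]].
pose f : {linear shifted_free L d -> X} := @shifted_ext L r d X m.
have fF p x : x \in mfil X p ->
    exists2 u, u \in mfil (shifted_free L d) p & f u = x.
  move=> /mE[c cF ->]; exists (\row_k c k).
    by apply/shifted_filP => k; rewrite mxE.
  by apply: eq_bigr => k _; rewrite mxE.
have f_fil : filtered f.
  move=> p u /shifted_filP uF.
  by apply/mE; exists (fun k => (u : 'rV[L]_r) 0 k).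
apply: (@FilteredCover L X (shifted_free L d) f) => //.
- exact: shifted_free_free.
- by move=> p x; split=> [[u uF <-]|[_ /fF]] //; split; [exists u|apply: f_fil].
by move=> x; have [p /fF[u _ uE]] := X_U x; exists u.
Qed.

Section FilteredKernel.
Variables (L : filtRing) (X Y : prefiltMod L) (f : {linear X -> Y}).

Definition ker_fil (p : int) : {pred kerMod f} := fun x => val x \in mfil X p.

Lemma ker_fil_zmod_closed p : zmod_closed (ker_fil p).
Proof.
split=> [|x y xF yF]; rewrite /ker_fil unfold_in ?raddf0 ?rpred0 //.
by rewrite raddfB rpredB.
Qed.
HB.instance Definition _ p :=
  GRing.isZmodClosed.Build (kerMod f) (ker_fil p) (ker_fil_zmod_closed p).

Lemma ker_filS p x : x \in ker_fil p -> x \in ker_fil (p + 1).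
Proof. exact: mfilS. Qed.

Lemma ker_filZ p q (a : L) x :
  a \in rfil L p -> x \in ker_fil q -> a *: x \in ker_fil (p + q).
Proof. exact: mfilZ. Qed.

Definition filtered_ker : prefiltMod L :=
  @PrefiltMod L (kerMod f) ker_fil ker_filS ker_filZ.

Hypothesis X_free : filtered_free X.

Lemma filtered_ker_filtration : is_filtration filtered_ker.
Proof.
have [r [d [e [ep basis]]]] := filtered_free_dual_basis X_free.
have [[p0 X0] X_U] := dual_basis_filtration basis.
split=> [|x]; last exact: X_U.
by exists p0 => p x pp0 xF; apply: val_inj; apply: X0 pp0 xF.
Qed.

(** The coordinate functionals of [X], restricted to the kernel, detect the filtration degree, so
    [cogenerated_good] applies. *)
Lemma filtered_ker_good : noetherian (grR L) -> good_filtration filtered_ker.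
Proof.
move=> gr_noeth.
have [r [d [e [ep [eF epF eE]]]]] := filtered_free_dual_basis X_free.
apply: (@cogenerated_good _ _ filtered_ker_filtration r (fun k => - d k)
  (fun k => to_hom (ep k \o val) : dual filtered_ker)) => // [k|p x xF x0].
  apply/mem_fdualP => q x xF.
  by have /mem_fdualP := epF k; apply.
suff : val (x : kerMod f) \in mfil X (p - 1) by [].
rewrite (eE (val (x : kerMod f))) rpred_sum // => k _.
by apply: mfil_le (mfilZ (x0 k) (eF k)); lia.
Qed.

End FilteredKernel.

Section ResolutionExists.
Variable L : filtRing.
Hypothesis gr_noeth : noetherian (grR L).

(** Bundling keeps the recursion on syzygies inside one type. *)
Record good_module := GoodModule {
  gm_mod :> prefiltMod L;
  gm_filtration : is_filtration gm_mod;
  gm_good : good_filtration gm_mod }.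

Definition gm_cover (X : good_module) : filtered_cover X :=
  good_filtered_cover (gm_filtration X) (gm_good X).

Definition gm_ker (X : good_module) : good_module :=
  let c := gm_cover X in
  GoodModule (filtered_ker_filtration (fc_map c) (fc_free c))
    (filtered_ker_good (fc_map c) (fc_free c) gr_noeth).

Variable N : good_module.

Fixpoint filtered_syzygy n :=
  if n is n'.+1 then gm_ker (filtered_syzygy n') else N.

Local Notation F n := (gm_cover (filtered_syzygy n)).

Definition filtered_d n : {linear F n.+1 -> F n} := val \o fc_map (F n.+1).

Lemma filtered_d_strict n : filtered (filtered_d n) /\ strict (filtered_d n).
Proof.
have d_fil : filtered (filtered_d n).
  by move=> p x xF; have := fc_filtered xF.
split=> // p y; split=> [[x xF <-]|[[x <-] xF]].
  by split; [exists x|apply: d_fil].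
have [_ H] := fc_strict (F n.+1) p (fc_map (F n.+1) x).
have [|x' x'F x'E] := H; first by split; [exists x|].
by exists x' => //; rewrite /= x'E.
Qed.

Lemma filtered_d_exact0 n : exact_at (filtered_d n) (fc_map (F n)).
Proof.
move=> y; split=> [y0|[x <-]]; last exact/eqP/(valP (fc_map (F n.+1) x)).
have yK : y \in ker_pred (fc_map (F n)) by apply/eqP.
have [x xE] := fc_onto (F n.+1) (Sub y yK : kerMod (fc_map (F n))).
by exists x; rewrite /= xE.
Qed.

Lemma filtered_d_exact n : exact_at (filtered_d n.+1) (filtered_d n).
Proof.
move=> y; rewrite -filtered_d_exact0.
have val0 := raddf0 (val : kerMod (fc_map (F n)) -> F n).
split=> [y0|y0]; last by rewrite /= y0.
by apply: val_inj; apply: (etrans y0); apply/esym/val0.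
Qed.

Lemma good_ff_resolution : ff_resolution N.
Proof.
apply: (@FFResolution L N (fun n => F n) filtered_d (fc_map (F 0))).
- by move=> n; apply: fc_free.
- exact: filtered_d_strict.
- by split; [apply: fc_filtered|apply: fc_strict].
- exact: fc_onto.
- exact: filtered_d_exact0.
exact: filtered_d_exact.
Qed.

End ResolutionExists.

(** * The bidual *)

Lemma null_zmod_morphism (A B : zmodType) : zmod_morphism ((fun=> 0) : A -> B).
Proof. by move=> x y; rewrite subr0. Qed.

Lemma null_filtered (A B : zmodType) (FA : int -> zmodClosed A)
    (FB : int -> zmodClosed B) p (x : A) : x \in FA p -> (0 : B) \in FB p.
Proof. by rewrite rpred0. Qed.

Definition null_fmorph (A B : zmodType) (FA : int -> zmodClosed A)
    (FB : int -> zmodClosed B) : fmorph FA FB :=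
  FMorph (@null_zmod_morphism A B) (@null_filtered A B FA FB).

Lemma gr_map_null (A B : zmodType) (FA : int -> zmodClosed A)
    (FB : int -> zmodClosed B) u : gr_map (null_fmorph FA FB) u = 0.
Proof. by apply: dirsumP => p; rewrite gr_mapE; apply: tau0. Qed.

Section GradedIsomorphism.
Variables (L L' : filtRing) (X : prefiltMod L) (Y : prefiltMod L').
Hypotheses (X_fil : is_filtration X) (Y_fil : is_filtration Y).
Variable f : fmorph (mfil X) (mfil Y).

Let X0 := null_fmorph (mfil X) (mfil X).
Let Y0 := null_fmorph (mfil Y) (mfil Y).

(** The exactness criterion is applied to [X -> X -> Y -> Y] with [f] in the middle and zero maps
    outside: exactness at [X] is injectivity of [f], and at [Y] surjectivity. *)
Lemma gr_map_bijP :
  bijective (gr_map f) <-> bijective f /\ @strict L L' X Y f.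
Proof.
have fX0 x : f (X0 x) = 0 by apply: fmorph0.
have Y0f x : Y0 (f x) = 0 by [].
split=> [f_bij|[f_bij fS]].
  have [|XE XS] := gr_exact_strict (@mfilS _ X) (@mfilS _ X) (@mfilS _ Y) fX0
      X_fil.1 X_fil.2.
    apply/exact_at_grP => // u.
    split=> [u0|[v <-]]; last by rewrite gr_map_null gr_map0.
    exists 0; rewrite gr_map_null; apply: (bij_inj f_bij).
    by rewrite u0 gr_map0.
  have [|YE _] := gr_exact_strict (@mfilS _ X) (@mfilS _ Y) (@mfilS _ Y) Y0f
      Y_fil.1 Y_fil.2.
    apply/exact_at_grP => // u; split=> [_|[v <-]]; last by rewrite gr_map_null.
    by have [g _ gK] := f_bij; exists (g u).
  have f_onto p y : y \in mfil Y p -> exists2 x, x \in mfil X p & f x = y.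
    by move=> yF; apply: YE.
  split.
    apply: inj_onto_bij => [x y xy|y].
      apply/eqP; rewrite -subr_eq0; apply/eqP.
      have [p xyF] := X_fil.2 (x - y).
      have [|z _ <- //] := XE p _ xyF.
      by rewrite fmorphB xy subrr.
    by have [p /f_onto[x _ xE]] := Y_fil.2 y; exists x.
  move=> p y; split=> [[x xF <-]|[_ /f_onto]] //.
  by split; [exists x|apply: fmorph_fil].
have XY : gr_exact (mfil X) (mfil X) (mfil Y) X0 f.
  apply: strict_exact_gr; [exact: mfilS|split=> [p x xF fx|p x fxF]].
    exists 0; first exact: rpred0.
    by apply: (bij_inj f_bij); rewrite fX0 fx.
  have [_ H] := fS p (f x).
  by have [|x' x'F x'E] := H; [split=> //; exists x|exists x'].
have YY : gr_exact (mfil X) (mfil Y) (mfil Y) f Y0.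
  apply: strict_exact_gr; [exact: mfilS|split=> [p y yF _|p y _]].
    have [_ H] := fS p y; apply: H; split=> //.
    by have [g _ gK] := f_bij; exists (g y).
  by exists 0; first exact: rpred0.
apply: inj_onto_bij => [u v uv|v].
  have fuv : gr_map f (u - v) = 0.
    by apply: (addIr (gr_map f v)); rewrite -gr_mapD subrK add0r.
  have [w wE] := ((exact_at_grP fX0).2 XY (u - v)).1 fuv.
  by apply/eqP; rewrite -subr_eq0 -wE gr_map_null.
have [H _] := (exact_at_grP Y0f).2 YY v.
by have [|w wE] := H; [rewrite gr_map_null|exists w].
Qed.

End GradedIsomorphism.

(** Evaluations at the generators of [X] detect the degree of a functional, so [cogenerated_good]
    applies over the opposite ring. *)
Lemma fdual_good (L : filtRing) (X : prefiltMod L) :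
  noetherian (grR (fopp L)) -> is_filtration X -> good_filtration X ->
  good_filtration (fdual X).
Proof.
move=> gr_noeth X_fil X_good.
have [r [d [m [mF X_gen _]]]] := good_filtration_gens X_fil X_good.
apply: (@cogenerated_good (fopp L) (fdual X) (fdual_is_filtration X_fil X_good)
  r d (fun k => theta (m k))) => // [k|p f fF f_m].
  apply/mem_fdualP => q f fF; rewrite addrC.
  by move/mem_fdualP: fF; apply; apply: mF.
apply/mem_fdualP => q x /X_gen[c cF ->].
rewrite (dual_sum (f : dual X)) rpred_sum // => k _.
by apply: rfil_le (rfilM (cF k) (f_m k)); lia.
Qed.

Section Theta.
Variables (L : filtRing) (M : prefiltMod L).
Local Notation M' := (fdual M).
Local Notation M'' := (fdual M').

Lemma theta_zmod_morphism : zmod_morphism (@theta L M).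
Proof. by move=> x y; apply: homP => f; apply: (evalBl f x y). Qed.

Lemma theta_filtered p (x : M) : x \in mfil M p -> theta x \in mfil M'' p.
Proof.
move=> xF; apply/mem_fdualP => q f fF; rewrite addrC.
by move/mem_fdualP: fF; apply.
Qed.

Definition theta_fmorph : fmorph (mfil M) (mfil M'') :=
  @FMorph _ _ (mfil M) (mfil M'') (@theta L M) theta_zmod_morphism
    theta_filtered.

(** On homogeneous elements both sides are the class of [f x]. *)
Lemma phi_gr_theta (x : gr (mfil M)) (u : grM M') :
  phi (gr_map theta_fmorph x : grM M'') u = phi u (x : grM M) :> gr (rfil L).
Proof.
rewrite -[LHS]/(gr_pair (eval_pairing M') u (gr_map theta_fmorph x)).
rewrite -[RHS]/(gr_pair (eval_pairing M) x u).
elim/gr_ind: x => [|x x' IH IH'|p x xF].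
- by rewrite gr_map0 gr_pair0l gr_pair0r.
- by rewrite gr_mapD gr_pairDl gr_pairDr IH IH'.
elim/gr_ind: u => [|u u' IH IH'|q f fF].
- by rewrite gr_pair0l gr_pair0r.
- by rewrite gr_pairDl gr_pairDr IH IH'.
rewrite gr_map_in // !gr_pair_in //; first by rewrite addrC.
exact: theta_filtered.
Qed.

Hypothesis phiM_bij : bijective (@phi L M).
Hypothesis phiM'_bij : bijective (@phi (fopp L) M').

Lemma theta_grP :
  bijective (@theta (grR L) (grM M)) <-> bijective (gr_map theta_fmorph).
Proof.
have [psi phiK psiK] := phiM_bij; have [psi' phi'K psi'K] := phiM'_bij.
have thetaE (x : grM M) v :
    theta x v = phi (gr_map theta_fmorph x : grM M'') (psi v) :> gr (rfil L).
  by rewrite phi_gr_theta psiK.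
split=> T_bij; apply: inj_onto_bij.
- move=> x y xy; apply: (bij_inj T_bij); apply: homP => v.
  by rewrite [LHS]thetaE xy -[LHS]thetaE.
(* The functional [phi w] is carried along [psi] to the dual of [gr M], where bijectivity of [theta]
   provides the preimage. *)
- move=> w; pose h0 v : gr (rfil L) := phi (w : grM M'') (psi v).
  have hL : linear (h0 : dual (grM M) -> (grR L)^c^o).
    move=> a u v; rewrite /h0.
    have -> : psi (a *: u + v) = (a : grR (fopp L)) *: psi u + psi v.
      by apply: (can_inj phiK); rewrite phiD phiZ !psiK.
    rewrite linearP; congr (_ + _); exact: grR_fopp_mul.
  pose h : dual (dual (grM M)) := to_hom (linear_of hL).
  have [T _ TK] := T_bij; exists (T h).
  apply: (@phi_inj (fopp L) M'); apply: homP => u.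
  by rewrite -[u]phiK -[LHS]thetaE TK.
- move=> x y xy; apply: (bij_inj T_bij); apply: (@phi_inj (fopp L) M').
  apply: homP => u; rewrite -[u]phiK -[LHS]thetaE xy; exact: thetaE.
(* Conversely [h] is carried along [phi] to [gr M'], and [psi'] turns the result into an element of
   [gr M'']. *)
move=> h; pose h0 (u : grM M') : gr (rfil L) := h (phi u).
have hL : linear (h0 : grM M' -> (grR (fopp L))^o).
  move=> a u v; rewrite /h0 phiD phiZ linearP; congr (_ + _).

  exact (esym (@grR_fopp_mul L a (h (phi u)))).
pose h' : dual (grM M') := to_hom (linear_of hL).
have [T _ TK] := T_bij; exists (T (psi' h')); apply: homP => v.
by rewrite [LHS]thetaE TK psi'K -[LHS]/(h (phi (psi v))) psiK.
Qed.

(** [phi] is a bijection from [gr] of the dual onto the dual of [gr], semilinear along the equality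
    of their scalar rings. *)
Lemma Ext_gr_fdual :
  (forall k, (0 < k)%N -> Ext_eq0 k (grM M') (grR (fopp L))^o) <->
  (forall k, (0 < k)%N -> Ext_eq0 k (dual (grM M)) (grR L)^c^o).
Proof.
apply: (Ext_eq0_transfer (e := grR_foppE L) phiM_bij
  (@phi_zmod_morphism L M)) => a u.
by rewrite phiZ grR_fopp_cast.
Qed.

End Theta.

(** * Equivalence of the graded and filtered conditions *)

Theorem theorem2p5 (L : filtRing) (M : prefiltMod L)
    (gr_comm : forall a b : grR L, a * b = b * a)
    (gr_noeth : noetherian (grR L))
    (M_fil : is_filtration M)
    (M_good : good_filtration M) :
  (Gdim0 (grM M) <->
    [/\ Gdim0 M,
        strict_dual_resolutions M,
        strict_dual_resolutions (fdual M)
      & strict (X := M) (Y := fdual (fdual M)) (@theta L M)])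
  /\
  (Gdim0 (grM M) -> bijective (@phi L M) /\ bijective (@phi (fopp L) (fdual M))).
Proof.
have grop_noeth : noetherian (grR (fopp L)).
  by case: _ / (grR_comm_fopp gr_comm).
have M'_fil := fdual_is_filtration M_fil M_good.
have M'_good := fdual_good grop_noeth M_fil M_good.
have M''_fil := fdual_is_filtration M'_fil M'_good.
(* Auxiliary resolutions of [M] and of its dual: they give access to [gr_Ext_eq0P], and conditions
   (2.2) and (2.2 dual) are later instantiated at them. *)
have F := good_ff_resolution gr_noeth (GoodModule M_fil M_good).
have G := good_ff_resolution grop_noeth (GoodModule M'_fil M'_good).
have theta_iff := gr_map_bijP M_fil M''_fil (theta_fmorph M).
have phi_bij : Gdim0 (grM M) ->
    bijective (@phi L M) /\ bijective (@phi (fopp L) (fdual M)).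
  move=> [_ E1 E2]; have [_ SF] := (gr_Ext_eq0P F).1 E1.
  have phiM := phi_bijective (SF 0%N); split=> //.
  have [_ SG] := (gr_Ext_eq0P G).1 ((Ext_gr_fdual phiM).2 E2).
  exact: phi_bijective (SG 0%N).
split=> //; split=> [GM|[[theta_bij E1 E2] SM SM' theta_strict]].
  have [phiM phiM'] := phi_bij GM; have [T E1 E2] := GM.
  have E2' := (Ext_gr_fdual phiM).2 E2.
  have [theta_bij theta_strict] := theta_iff.1 ((theta_grP phiM phiM').1 T).
  split=> //.
  - split=> //; first exact: ((gr_Ext_eq0P F).1 E1).1.
    exact: ((gr_Ext_eq0P G).1 E2').1.
  (* [gr_Ext_eq0P] holds for every filtered free resolution, so strictness follows for all of them
     from the same vanishing. *)
  - by move=> F'; exact: ((gr_Ext_eq0P F').1 E1).2.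
  by move=> G'; exact: ((gr_Ext_eq0P G').1 E2').2.
have phiM := phi_bijective (SM F 0%N).
have phiM' := phi_bijective (SM' G 0%N).
split.
- by apply/(theta_grP phiM phiM')/theta_iff.
- by apply/(gr_Ext_eq0P F); split=> //; apply: SM.
apply/(Ext_gr_fdual phiM)/(gr_Ext_eq0P G); split=> //; exact: SM'.
Qed.
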